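(* Fix $\delta\in(0,1)$, $\eta_1,\eta_2\geq0$, and a collection $\mathcal S$ of measurable sets with $\mathrm{VC}(\mathcal S)<+\infty$. Let $f_0\succeq f_1$ be trade-off functions, and let $$\psi_{n,\delta}=\mathbf 1\bigl\{\exists S\in\mathcal S:\ h_+(Q_n(S^{c}))<f_0(h_+(P_n(S)))\bigr\}.$$ Then: (i) (Type I error control, assumption-free.) $\displaystyle\sup_{(P,Q):\,T(P,Q)\succeq f_0}(P^n\times Q^n)(\psi_{n,\delta})\leq\delta$, the supremum being over arbitrary pairs of distributions. (ii) (Type II error control under approximate attainability.) If $$\forall\alpha\in[0,1]:\qquad f_1(\alpha)\leq\max\bigl\{h_+^{\leftarrow}\circ h_+^{\leftarrow}\circ f_0\circ h_+\circ h_+(\alpha+2\eta_1)-2\eta_2,\;0\bigr\},$$ then $$\sup_{(P,Q)\in\mathcal M_{\mathcal S,\eta_1,\eta_2}:\,T(P,Q)\not\succeq f_1}(P^n\times Q^n)(1-\psi_{n,\delta})\leq\delta .$$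
   Context: Trade-off functions: for probability distributions $P,Q$ on a measurable space $(\mathcal X,\mathcal A)$, $T(P,Q)(\alpha)=\inf\{E_Q[1-\varphi]:\ \varphi:\mathcal X\to[0,1]\text{ measurable},\ E_P[\varphi]\leq\alpha\}$, $\alpha\in[0,1]$. A trade-off function is a convex, continuous, non-increasing $f:[0,1]\to[0,1]$ with $f(\alpha)\leq1-\alpha$; it is extended by $f(\alpha)=0$ for $\alpha>1$. $f\succeq g$ means $f(\alpha)\geq g(\alpha)$ for all $\alpha\in[0,1]$; $f\not\succeq g$ means $f(\alpha_0)<g(\alpha_0)$ for some $\alpha_0\in[0,1]$. Data: $X_{1:n}\sim P^n$ and $Y_{1:n}\sim Q^n$ are independent samples with empirical distributions $P_n,Q_n$; $(P^n\times Q^n)(\psi)$ is the expectation of the test $\psi$ (value $1$ = rejection). $\mathrm{VC}(\mathcal S)$ is the VC dimension. $\tau_{n,\delta}=\frac{4\{\mathrm{VC}(\mathcal S)\log(2n)+\log(32/\delta)\}}{n}$, with $n$ always assumed large enough that $\tau_{n,\delta}\leq\frac12$; $V(t)=\min\{t,(1-t)_+\}$ and $h_+(t)=\min\{t+\sqrt{\tau_{n,\delta}V(t)}+\tau_{n,\delta},1\}$ for $t\in[0,\infty)$; $h_+^{\leftarrow}(t)=\inf\{s\in[0,1]:h_+(s)\geq t\}$ for $t\in[0,1]$. Attainability: for a class $\mathcal S\subset\mathcal A$ containing $\emptyset$ and $\mathcal X$, a pair $(P,Q)$ is $\mathcal S$-attainable if, with $\mu=(P+Q)/2$, $p=dP/d\mu$,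 $q=dQ/d\mu$, for every $\lambda\in[0,\infty]$ there is $S\in\mathcal S$ with $\mathbf 1_S=\mathbf 1_{\{q>\lambda p\}}$ $\mu$-a.e. (for $\lambda=\infty$, $\{q>\lambda p\}$ means $\{p=0\}$); $\mathcal M_{\mathcal S}$ is the set of all $\mathcal S$-attainable pairs. Approximate attainability: $\mathcal M_{\mathcal S,\eta_1,\eta_2}=\{(P,Q):\exists(P',Q')\in\mathcal M_{\mathcal S}\text{ with }d_{\mathrm{TV}}(P,P')\leq\eta_1,\ d_{\mathrm{TV}}(Q,Q')\leq\eta_2\}$, where $d_{\mathrm{TV}}(P,P')=\sup_A|P(A)-P'(A)|$.
   Formalization: The collection S is further assumed to have measurable traces: for every k and every 0-1 pattern, the set of k-point samples on which some S in the collection induces that pattern is measurable; without such a condition the test may be non-measurable and its expectation undefined. *)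

(* Defs.v *)
From HB Require Import structures.
From mathcomp Require Import all_boot all_order all_algebra.
From mathcomp Require Import all_classical all_reals all_analysis.

Set Implicit Arguments.
Unset Strict Implicit.
Unset Printing Implicit Defensive.
Import Order.TTheory GRing.Theory Num.Theory.
Import numFieldNormedType.Exports.

Local Open Scope classical_set_scope.
Local Open Scope ring_scope.

Section tradeoff.
Context d (T : measurableType d) (R : realType).
Implicit Types (P Q : probability T R) (f g : R -> R) (phi : T -> R).

Definition is_test phi :=
  measurable_fun [set: T] phi /\ forall x, 0 <= phi x <= 1.

Definition tradeoff P Q (a : R) : R :=
  inf [set \int[Q]_x (1 - phi x) |
       phi in [set phi | is_test phi /\ \int[P]_x phi x <= a]].

(* Only the values on [0, 1] matter, except that tf_ext fixes the convention
   f = 0 to the right of 1. *)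
Record is_tradeoff_function (f : R -> R) : Prop := {
  tf_convex : @convex_function R R^o `[0, 1] f ;
  tf_continuous : {within `[0, 1], continuous f} ;
  tf_nonincreasing : {in `[0, 1] &, {homo f : a b / a <= b >-> b <= a}} ;
  tf_range : {in `[0, 1], forall a, 0 <= f a <= 1} ;
  tf_le : {in `[0, 1], forall a, f a <= 1 - a} ;
  tf_ext : forall a, 1 < a -> f a = 0 }.

Definition tf_ge f g := forall a, 0 <= a <= 1 -> g a <= f a.

Definition tf_nge f g := exists2 a, 0 <= a <= 1 & f a < g a.

End tradeoff.

Section vc.
Context (T : Type) (R : realType).
Implicit Types (SS : set (set T)) (A : set T).

Definition shatters SS A := forall B, B `<=` A -> exists2 S, SS S & A `&` S = B.

Definition VC SS : \bar R :=
  ereal_sup [set k%:R%:E | k in [set k | exists2 A, (A #= `I_k)%card & shatters SS A]].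

End vc.
Arguments VC {T} R SS.

Section inflation.
Context (T : Type) (R : realType) (SS : set (set T)) (n : nat) (delta : R).

(* `fine` is harmless: VC R SS is the supremum of a set of naturals, assumed
   < +oo; for SS empty it is -oo, which `fine` sends to 0. *)
Definition tau : R :=
  4 * (fine (VC R SS) * ln (2 * n%:R) + ln (32 / delta)) / n%:R.

Definition Vfun (t : R) : R := Num.min t (Num.max (1 - t) 0).

Definition hplus (t : R) : R :=
  Num.min (t + Num.sqrt (tau * Vfun t) + tau) 1.

Definition hplus_inv (t : R) : R := inf [set s | 0 <= s <= 1 /\ t <= hplus s].

End inflation.

Section sample.
Context d (T : measurableType d) (R : realType).

Definition cons_pair n (xz : T * n.-tuple T) : n.+1.-tuple T :=
  [tuple of xz.1 :: xz.2].

Let measurable_cons_pair n : measurable_fun setT (@cons_pair n).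
Proof. exact: measurable_cons. Qed.

HB.instance Definition _ n :=
  isMeasurableFun.Build _ _ _ _ (@cons_pair n) (@measurable_cons_pair n).

(* The n-fold product measure P^n on n.-tuple T; see powerE. *)
Fixpoint power (P : probability T R) n : probability (n.-tuple T) R :=
  match n with
  | 0 => dirac ([tuple] : 0.-tuple T)
  | m.+1 => distribution (P \x power P m)%E (@cons_pair m)
  end.

Lemma powerE (P : probability T R) n (A : 'I_n -> set T) :
  (forall i, measurable (A i)) ->
  power P n [set z | forall i, A i (tnth z i)] = (\prod_(i < n) P (A i))%E.
Proof.
elim: n A => [|n IHn] A mA /=.
  by rewrite big_ord0 diracE mem_set //= => -[].
rewrite /distribution /pushforward big_ord_recl -IHn; last by move=> i.
have -> : @cons_pair n @^-1` [set z | forall i, A i (tnth z i)] =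
    A ord0 `*` [set z | forall i, A (lift ord0 i) (tnth z i)].
  apply/seteqP; split=> [[x z] /= h|[x z] [/= h0 h] i].
    by split=> [|i]; [exact: (h ord0)|move: (h (lift ord0 i)); rewrite tnthS].
  by case: (unliftP ord0 i) => [j|] ->; rewrite ?tnthS.
rewrite product_measure1E //.
rewrite (_ : [set z | _] = \bigcap_i (@tnth n T ^~ i @^-1` A (lift ord0 i))).
  apply: fin_bigcap_measurable => [|i _]; first exact: finite_finset.
  by rewrite -[X in measurable X]setTI; exact: measurable_tnth.
by apply/seteqP; split=> z /= h i; [move=> _|]; exact: h.
Qed.

Definition empirical n (x : n.-tuple T) (S : set T) : R :=
  (\sum_(i < n) \1_S (tnth x i)) / n%:R.

(* For every k, the set of samples on which SS induces a given trace is
   measurable. This makes psi below (a supremum over a possibly uncountable SS)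
   and the suprema in the Vapnik-Chervonenkis inequalities measurable; without
   a regularity condition of this kind those inequalities can fail. It holds
   whenever SS is a countable collection of measurable sets. *)
Definition measurable_traces (SS : set (set T)) :=
  forall k (B : {set 'I_k}),
    measurable [set z : k.-tuple T |
      exists2 S, SS S & forall i, S (tnth z i) <-> i \in B].

Definition psi (SS : set (set T)) n (delta : R) (f0 : R -> R)
    (xy : n.-tuple T * n.-tuple T) : R :=
  let h := hplus SS n delta in
  \1_[set xy : n.-tuple T * n.-tuple T | exists2 S, SS S &
        h (empirical xy.2 (~` S)) < f0 (h (empirical xy.1 S))] xy.

Definition expect2 n (P Q : probability T R)
    (phi : n.-tuple T * n.-tuple T -> R) : \bar R :=
  ('E_((power P n \x power Q n)%E)[phi])%E.

End sample.

Section attainability.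
Context d (T : measurableType d) (R : realType).
Implicit Types (P Q : probability T R) (SS : set (set T)).

Definition midpoint P Q : set T -> \bar R :=
  mscale (2^-1)%:nng (measure_add P Q).

HB.instance Definition _ P Q := Measure.on (midpoint P Q).

Let midpoint_setT P Q : midpoint P Q setT = 1%E.
Proof.
rewrite /midpoint /mscale [X in (_ * X)%E](measure_addE P Q).
rewrite [X in (_ * (X + _))%E](@probability_setT _ _ _ P).
rewrite [X in (_ * (_ + X))%E](@probability_setT _ _ _ Q).
by rewrite -EFinD -EFinM /= -[1 + 1]/(2%:R) mulVf.
Qed.

HB.instance Definition _ P Q :=
  Measure_isProbability.Build _ _ _ (midpoint P Q) (@midpoint_setT P Q).

Definition density P Q (N : probability T R) : T -> \bar R :=
  Radon_Nikodym (charge_of_finite_measure N) (midpoint P Q).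

(* {q > l p}; at l = +oo this is {p = 0}, not the literal {q > +oo * p}. *)
Definition NP_region P Q (l : \bar R) : set T :=
  if l == +oo%E then [set x | density P Q P x = 0%E]
  else [set x | (l * density P Q P x < density P Q Q x)%E].

Definition attainable SS P Q :=
  forall l : \bar R, (0 <= l)%E -> exists2 S, SS S &
    {ae midpoint P Q, forall x, \1_S x = \1_(NP_region P Q l) x :> R}.

Definition dTV P Q : R := sup [set `|fine (P A) - fine (Q A)| | A in measurable].

Definition approx_attainable SS (eta1 eta2 : R) P Q :=
  exists P' Q', [/\ attainable SS P' Q', dTV P P' <= eta1 & dTV Q Q' <= eta2].

End attainability.

(* Main.v *)
From HB Require Import structures.
Require Import Defs.
From mathcomp Require Import all_boot all_order all_algebra.
From mathcomp Require Import all_classical all_reals all_analysis measurable_realfun.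
From mathcomp Require Import ring lra zify.
Set Implicit Arguments.
Unset Strict Implicit.
Unset Printing Implicit Defensive.
Import Order.TTheory GRing.Theory Num.Theory.
Import numFieldNormedType.Exports.
Local Open Scope classical_set_scope.
Local Open Scope ring_scope.

(** The test compares, over the sets S of the class, the inflated empirical
type II error with f0 at the inflated empirical type I error.  Everything
follows from two deviation bounds.

Uniform bound ([uniform_upper_bound]): outside an event of probability
delta / 2, P S <= h (P_n S) for all S of the class at once, where h is the
inflation map h_+.  This is a relative Vapnik-Chervonenkis inequality, with a
deviation of the order of the standard deviation.  If it fails at S, then a
ghost sample, which counts at least n P(S) - 2 points of S with probability at
least 1/8 ([count_in_near_mean]), makes the count of S in the ghost sample exceed the
count in the sample by a large multiple of sqrt (min (N, 2n - N)), where N is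
the total count ([ghost_above]).  Exchanging the i-th points of the two samples
at random preserves their joint law ([power_swap]) and N, so Hoeffding's bound
for Rademacher sums controls each trace of the class on the 2n points
([excess_swaps]); the number of traces is bounded by Sauer and Shelah
([card_traces_le]).  Using min (N, 2n - N) treats the sets of small and of large
probability in a single event, and the factor 8 of the ghost sample times the
factor 2 in the number of traces consumes exactly the constant 32 of tau.

Pointwise bound ([single_lower_bound]): for one fixed set, P_n S <= h (P S)
outside an event of probability delta / 2.  It is the same symmetrization
applied to the class whose only element is the complement of S.

Type I error.  If T(P, Q) >= f0, then on the uniform event for P over the class
and for Q over the complements, f0 (h (P_n S)) <= f0 (P S) <= T(P, Q)(P S) <=
Q (~ S) <= h (Q_n (~ S)) for all S, and the test accepts.

Type II error.  By the pointwise bounds it is enough to find one S with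
h (h (Q (~ S))) < f0 (h (h (P S))), see [exists_separating_set].  The function
G = h<- o h<- o f0 o h o h is convex and nonincreasing, since f0 is, and since h
is concave and nondecreasing.  A test phi that beats f1 gives a point lying below
the graph of G by more than the shifts by 2 eta1 and 2 eta2.  Let -lambda be the
slope of a line supporting G there.  By attainability the class contains the
Neyman-Pearson region of threshold lambda for the attainable pair close to
(P, Q), and this region does at least as well as phi in the direction
(lambda, 1).  If it did not separate, its errors would lie above the graph of G,
hence above the supporting line, which contradicts the choice of phi. *)

(** * Shattering in finite sets *)

Section sauer.
Import fintype boot.finset.
Local Close Scope classical_set_scope.
Local Open Scope nat_scope.
Variable I : finType.
Implicit Types (F : {set {set I}}) (A B C : {set I}) (x : I).

(** Boolean shattering, so that the shattered sets form a finite set to count. *)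
Definition fshatters F A :=
  [forall B : {set I}, (B \subset A) ==> [exists C in F, A :&: C == B]].

Lemma fshattersP F A :
  reflect (forall B, B \subset A -> exists2 C, C \in F & A :&: C = B)
          (fshatters F A).
Proof.
apply: (iffP forallP) => h B.
  by move=> BA; have /implyP/(_ BA)/exists_inP[C CF /eqP] := h B; exists C.
apply/implyP => /h[C CF e]; apply/exists_inP; exists C => //; exact/eqP.
Qed.

Lemma fshattersS F (G : {set {set I}}) A : F \subset G -> fshatters F A -> fshatters G A.
Proof.
move=> FG /fshattersP h; apply/fshattersP => B /h[C CF e].
by exists C => //; exact: (subsetP FG).
Qed.

(** Pajor's form of the Sauer-Shelah lemma, which counts the shattered sets instead
of bounding their sizes.  Split F at a point x where two members differ.  No set
shattered by either half contains x, and a set shattered by both halves is still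
shattered by F after adding x, so the numbers of shattered sets add up as the
cardinals do. *)
Lemma card_le_shattered F : #|F| <= #|[set A | fshatters F A]|.
Proof.
have [m] := ubnP #|F|; elim: m F => // m IH F.
rewrite ltnS => Fm; have [F1|] := leqP #|F| 1.
  have [->|/set0Pn[C CF]] := eqVneq F set0; first by rewrite cards0.
  apply: leq_trans F1 _; apply/card_gt0P; exists set0; rewrite inE.
  apply/fshattersP => B; rewrite subset0 => /eqP ->.
  by exists C => //; rewrite set0I.
move=> /card_gt1P[C [D [CF DF CD]]].
have [x xCD] : exists x, (x \in C) != (x \in D).
  apply/existsP; apply: contraNT CD => /existsPn CD; apply/eqP/setP => x.
  by have /negPn/eqP := CD x.
pose F1 := [set A in F | x \in A]; pose F0 := [set A in F | x \notin A].
have F01 : #|F| = #|F1| + #|F0|.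
  rewrite -cardsUI (_ : F1 :&: F0 = set0) ?cards0 ?addn0.
    by congr #|pred_of_set _|; apply/setP => A; rewrite !inE -andb_orr orbN andbT.
  by apply/setP => A; rewrite !inE; case: (x \in A); rewrite ?andbF.
have F1p : 0 < #|F1|.
  apply/card_gt0P; move: xCD; case: (boolP (x \in C)) => xC; case: (boolP (x \in D)) => xD //= _.
    by exists C; rewrite inE CF.
  by exists D; rewrite inE DF.
have F0p : 0 < #|F0|.
  apply/card_gt0P; move: xCD; case: (boolP (x \in C)) => xC; case: (boolP (x \in D)) => xD //= _.
    by exists D; rewrite inE DF.
  by exists C; rewrite inE CF.
have h1 := IH F1 ltac:(lia); have h0 := IH F0 ltac:(lia).
rewrite F01; apply: leq_trans (leq_add h1 h0) _.
have x1 A : fshatters F1 A -> x \notin A.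
  move=> /fshattersP /(_ set0 (sub0set _))[E]; rewrite inE => /andP[_ xE] AE.
  apply/negP => xA; have : x \in A :&: E by rewrite inE xA.
  by rewrite AE inE.
have x0 A : fshatters F0 A -> x \notin A.
  move=> /fshattersP /(_ A (subxx _))[E]; rewrite inE => /andP[_ xE] AE.
  by rewrite -AE inE (negbTE xE) andbF.
rewrite -cardsUI.
set S0 := [set A | fshatters F0 A]; set S1 := [set A | fshatters F1 A].
have inj : {in S1 :&: S0 &, injective (fun A => x |: A)}.
  move=> A B; rewrite !inE => /andP[/x1 xA _] /andP[/x1 xB _] e.
  by rewrite -(setU1K xA) e setU1K.
rewrite -(card_in_imset inj) -cardsUI [X in _ + X](_ : _ = 0) ?addn0; last first.
  apply/eqP; rewrite cards_eq0; apply/eqP/setP => A; rewrite !inE.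
  apply/negbTE/negP => /andP[h /imsetP[B _ e]].
  by case/orP: h => [/x1|/x0]; rewrite e setU11.
apply/subset_leq_card/subsetP => A.
have sF1 : F1 \subset F by apply/subsetP => B; rewrite inE => /andP[].
have sF0 : F0 \subset F by apply/subsetP => B; rewrite inE => /andP[].
rewrite !inE => /orP[/orP[] h|]; [exact: fshattersS h|exact: fshattersS h|].
case/imsetP => B; rewrite !inE => /andP[/[dup] /x1 xB /fshattersP B1 /fshattersP B0] ->.
apply/fshattersP => E EB; case: (boolP (x \in E)) => xE.
  have [|G] := B1 (E :\ x).
    by rewrite subDset.
  rewrite inE => /andP[GF xG] e; exists G => //.
  by rewrite setIUl e (setIidPl _) ?sub1set// setD1K.
have [|G] := B0 E.
  apply/subsetP => y yE; have := subsetP EB y yE; rewrite !inE => /orP[/eqP yx|//].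
  by rewrite -yx yE in xE.
rewrite inE => /andP[GF xG] e; exists G => //.
rewrite setIUl e; apply/setP => y; rewrite !inE.
by case: eqVneq => [->|//]; rewrite (negbTE xG) (negbTE xE).
Qed.

Lemma card_small_sets (k : nat) :
  #|[set A : {set I} | (#|A| <= k)%N]| = (\sum_(i < k.+1) 'C(#|I|, i))%N.
Proof.
rewrite -sum1_card (eq_bigl (fun A : {set I} => (#|A| < k.+1)%N)); last by move=> A; rewrite inE.
rewrite (partition_big (fun A : {set I} => inord #|A| : 'I_k.+1) predT)//=.
apply: eq_bigr => i _; rewrite -card_draws -sum1_card; apply: eq_bigl => A; rewrite !inE.
case: ltnP => h /=; first by rewrite -val_eqE /= inordK.
apply/esym/negbTE; apply: contraL h => /eqP ->; rewrite -ltnNge; exact: ltn_ord.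
Qed.

End sauer.

(** The additive 1 makes the induction go through: each further binomial
coefficient 'C(m, k.+2) and m ^ k.+1 are both at most half of m ^ k.+2. *)
Lemma sum_bin_le (m k : nat) : (2 <= m)%N ->
  (\sum_(i < k.+1) 'C(m, i) <= m ^ k + 1)%N.
Proof.
move=> m2; elim: k => [|k IH]; first by rewrite big_ord1 bin0.
rewrite big_ord_recr /=; case: k IH => [|k] IH.
  by rewrite big_ord1 bin0 bin1 expn1 addnC.
apply: leq_trans (leq_add IH (leqnn _)) _.
have h1 : (2 * 'C(m, k.+2) <= m ^ k.+2)%N.
  have -> : (m ^ k.+2 = \prod_(i < k.+2) m)%N by rewrite prod_nat_const card_ord.
  apply: leq_trans (_ : 'C(m, k.+2) * (k.+2)`! <= _)%N.
    rewrite mulnC leq_mul2l; apply/orP; right.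
    by rewrite !factS mulSn; have := fact_gt0 k; nia.
  rewrite bin_ffact ffact_prod.
  by apply: leq_prod => i _; exact: leq_subr.
have h2 : (2 * m ^ k.+1 <= m ^ k.+2)%N by rewrite [(m ^ k.+2)%N]expnS leq_mul2r m2 orbT.
lia.
Qed.

(** * Tails of Rademacher sums *)

(** For functions with a derivative everywhere, in the form needed to compare
the two sides of an inequality on the half-line. *)
Lemma ge0_of_derive (R : realType) (f f' : R -> R) :
  (forall x : R, is_derive x (1 : R) f (f' x)) -> (forall x : R, (0 <= x)%R -> 0 <= f' x) ->
  forall x : R, 0 <= x -> f 0 <= f x.
Proof.
move=> df f'0 x x0; have dbl y : derivable f y 1 by case: (df y).
apply: (@ger0_derive1_le _ _ 0 x _ _ true false) => //.
- move=> y; rewrite in_itv /= => /andP[y0 _].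
  by rewrite derive1E; have [_ ->] := df y; exact/f'0/ltW.
- apply: continuous_subspaceT => y; exact/differentiable_continuous/derivable1_diffP/dbl.
- by rewrite in_itv /= lexx.
- by rewrite in_itv /= x0 lexx.
Qed.

(** The function cosh x * exp (- x^2 / 2) decreases on x >= 0: its derivative has
the sign of sinh x - x cosh x, which vanishes at 0 and has derivative - x sinh x. *)
Lemma cosh_le_ge0 (R : realType) (x : R) : 0 <= x ->
  expR x + expR (- x) <= 2 * expR (x ^+ 2 / 2).
Proof.
move=> x0; pose h (y : R) := y * (expR y + expR (- y)) - (expR y - expR (- y)).
have h_ge0 y : 0 <= y -> 0 <= h y.
  move=> y0; have -> : 0 = h 0 by rewrite /h mul0r oppr0 expR0 subrr subr0.
  apply: (@ge0_of_derive _ h (fun z => z * (expR z - expR (- z)))) y0 => z.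
    apply: is_derive_eq; rewrite /GRing.scale/=; ring.
  by move=> z0; rewrite mulr_ge0// subr_ge0 ler_expR; lra.
have key : - (expR 0 + expR (- 0)) * expR (- (0 ^+ 2 / 2)) <=
    - (expR x + expR (- x)) * expR (- (x ^+ 2 / 2)).
  apply: (@ge0_of_derive _ (fun x => - (expR x + expR (- x)) * expR (- (x ^+ 2 / 2)))
    (fun x => h x * expR (- (x ^+ 2 / 2)))) x0 => y.
    apply: is_derive_eq; rewrite /GRing.scale/= /h; by field; rewrite ?pnatr_eq0.
  by move=> y0; rewrite mulr_ge0 ?expR_ge0 ?h_ge0.
move: key; rewrite expr0n /= mul0r !oppr0 !expR0 mulr1 mulNr lerN2 (expRN (_ / 2)).
by rewrite ler_pdivrMr ?expR_gt0 // -(natrD _ 1 1).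
Qed.

Lemma cosh_le (R : realType) (x : R) :
  expR x + expR (- x) <= 2 * expR (x ^+ 2 / 2).
Proof.
have [/cosh_le_ge0//|x0] := leP 0 x.
have /cosh_le_ge0 : 0 <= - x by lra.
by rewrite opprK sqrrN addrC.
Qed.

(** Hoeffding's exponential bound for random signs, stated as a count of sign
vectors, with parameter r / V in the exponential moment. *)
Lemma rademacher_tail (R : realType) (I : finType) (c : I -> R) (V r : R) :
  0 < V -> \sum_i c i ^+ 2 <= V -> 0 <= r ->
  \sum_(e : {ffun I -> bool} | r <= \sum_i (-1) ^+ e i * c i) 1 <=
    2 ^+ #|I| * expR (- (r ^+ 2 / (2 * V))).
Proof.
move=> V0 cV r0; pose t := r / V.
apply: le_trans (_ : \sum_(e : {ffun I -> bool})
    expR (- (t * r)) * \prod_i expR (t * ((-1) ^+ e i * c i)) <= _).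
  rewrite big_mkcond; apply: ler_sum => e _ /=; case: ifPn => [re|_].
    rewrite -expR_sum -expRD -[leLHS]expR0 ler_expR -mulr_sumr addrC -mulrBr.
    by rewrite mulr_ge0 ?subr_ge0// divr_ge0// ltW.
  by rewrite mulr_ge0 ?expR_ge0// prodr_ge0// => i _; rewrite expR_ge0.
rewrite -mulr_sumr.
rewrite -(bigA_distr_bigA (fun i (b : bool) => expR (t * ((-1) ^+ b * c i)))) /=.
apply: le_trans (_ : expR (- (t * r)) * \prod_(i : I) (2 * expR ((t * c i) ^+ 2 / 2)) <= _).
  rewrite ler_wpM2l ?expR_ge0//; apply: ler_prod => i _.
  rewrite big_bool /= expr1 expr0 mul1r mulN1r mulrN addrC cosh_le andbT.
  by rewrite addr_ge0 ?expR_ge0.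
rewrite big_split /= prodr_const mulrCA ler_wpM2l ?exprn_ge0//.
rewrite -expR_sum -expRD ler_expR.
rewrite (eq_bigr (fun i => t ^+ 2 / 2 * c i ^+ 2)); last by move=> i _; rewrite exprMn; ring.
rewrite -mulr_sumr; apply: le_trans (_ : - (t * r) + t ^+ 2 / 2 * V <= _).
  by rewrite lerD2l ler_wpM2l// divr_ge0// sqr_ge0.
rewrite le_eqVlt /t; apply/orP; left; apply/eqP; field.
by rewrite gt_eqF.
Qed.

(** * Product measures and coordinate swaps *)

Section power_measure.
Context d (T : measurableType d) (R : realType).
Implicit Type P : probability T R.

Definition box n (A : 'I_n -> set T) : set (n.-tuple T) :=
  [set z | forall i, A i (tnth z i)].

Lemma measurable_box n (A : 'I_n -> set T) :
  (forall i, measurable (A i)) -> measurable (box A).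
Proof.
move=> mA; have -> : box A = \bigcap_i (@tnth n T ^~ i @^-1` A i).
  by apply/seteqP; split=> z /= h i; [move=> _|]; exact: h.
apply: fin_bigcap_measurable => [|i _]; first exact: finite_finset.
by rewrite -[X in measurable X]setTI; exact: measurable_tnth.
Qed.

(** Boxes are stable under intersection and generate the product sigma-algebra. *)
Lemma power_unique P n (m : {measure set (n.-tuple T) -> \bar R}) :
  (forall A : 'I_n -> set T, (forall i, measurable (A i)) ->
     m (box A) = (\prod_(i < n) P (A i))%E) ->
  forall D, measurable D -> m D = power P n D.
Proof.
move=> mE D mD.
pose G : set (set (n.-tuple T)) :=
  [set box A | A in [set A | forall i, measurable (A i)]].
have boxT : box (fun _ : 'I_n => setT) = setT by apply/seteqP; split.
apply: (measure_unique G (fun _ => setT)) => //.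
- apply/seteqP; split; last first.
    apply: smallest_sub; first exact: sigma_algebra_measurable.
    by move=> _ [A mA <-]; exact: measurable_box.
  apply: sub_smallest2r; first exact: smallest_sigma_algebra.
  move=> C; rewrite -bigcup_seq => -[i _ [Y mY <-]].
  exists (fun j => if j == i then Y else setT).
    by move=> j; case: ifP.
  apply/seteqP; split=> z /=.
    by move=> /(_ i); rewrite eqxx.
  by move=> [_ Yz] j; case: eqP => // ->.
- move=> _ _ [A mA <-] [B mB <-]; exists (fun i => A i `&` B i).
    by move=> i; exact: measurableI.
  apply/seteqP; split=> z /=; first by move=> h; split=> i; have [] := h i.
  by move=> [h1 h2] i; split; [exact: h1|exact: h2].
- by move=> _; exists (fun _ => setT).
- by rewrite bigcup_const.
- by move=> _ [A mA <-]; rewrite mE// -powerE.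
- move=> _; rewrite -boxT mE//; apply: (@le_lt_trans _ _ 1%E); last exact: ltry.
  by rewrite big1// => i _; exact: probability_setT.
Qed.

(** Exchanges are followed by concatenation, because the traces of the class on both
samples together are traces on a single tuple of 2n points. *)
Definition swap n (e : {ffun 'I_n -> bool}) (z : n.-tuple T * n.-tuple T) :
    (n + n).-tuple T :=
  [tuple match fintype.split j with
         | inl i => tnth (if e i then z.2 else z.1) i
         | inr i => tnth (if e i then z.1 else z.2) i
         end | j < n + n].

Lemma measurable_swap n (e : {ffun 'I_n -> bool}) :
  measurable_fun [set: n.-tuple T * n.-tuple T] (swap e).
Proof.
apply/measurable_fun_tnthP => j.
have -> : @tnth _ T ^~ j \o swap e = (fun z => match fintype.split j with
         | inl i => tnth (if e i then z.2 else z.1) i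
         | inr i => tnth (if e i then z.1 else z.2) i
         end) by apply/funext => z /=; rewrite tnth_mktuple.
by case: (fintype.split j) => i; case: (e i);
  apply: (measurableT_comp (measurable_tnth i)).
Qed.

HB.instance Definition _ n (e : {ffun 'I_n -> bool}) :=
  isMeasurableFun.Build _ _ _ _ (swap e) (@measurable_swap n e).

(** The preimage of a box is a product of two boxes, whatever is exchanged. *)
Lemma power_swap P n (e : {ffun 'I_n -> bool}) D : measurable D ->
  (power P n \x power P n)%E (swap e @^-1` D) = power P (n + n) D.
Proof.
move=> mD.
apply: (@power_unique P (n + n) (distribution (power P n \x power P n)%E (swap e))) => // A mA.
pose A1 i := A (if e i then rshift n i else lshift n i).
pose A2 i := A (if e i then lshift n i else rshift n i).
transitivity ((power P n \x power P n)%E (swap e @^-1` box A)); first by [].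
have -> : swap e @^-1` box A = box A1 `*` box A2.
  apply/seteqP; split=> [[x y]|[x y] [h1 h2] j] /=.
    move=> h; split=> i.
      have := h (if e i then rshift n i else lshift n i).
      by rewrite tnth_mktuple /A1; case: ifP => ei;
        rewrite ?(unsplitK (inr i)) ?(unsplitK (inl i)) ei.
    have := h (if e i then lshift n i else rshift n i).
    by rewrite tnth_mktuple /A2; case: ifP => ei;
      rewrite ?(unsplitK (inr i)) ?(unsplitK (inl i)) ei.
  rewrite tnth_mktuple /= -[j in A j]splitK.
  by case: (fintype.split j) => i /=; have := h1 i; have := h2 i; rewrite /A1 /A2; case: (e i).
rewrite product_measure1E; [|by apply: measurable_box => i; exact: mA..].
rewrite [X in (X * _)%E]powerE; last by move=> i; exact: mA.
rewrite [X in (_ * X)%E]powerE; last by move=> i; exact: mA.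
rewrite big_split_ord /= -!big_split /=; apply: eq_bigr => i _.
by rewrite /A1 /A2; case: (e i); rewrite // muleC.
Qed.

End power_measure.

(** * Binomial variables near or above their mean *)

Section binomial.
Variables (R : realType) (p : R).
Hypothesis p01 : 0 <= p <= 1.

(** Expectation of F (j + K) with K binomial of parameters n and p, by recursion
on the number of trials; it mirrors the recursive construction of the product
measure. *)
Fixpoint binexp (n : nat) (F : nat -> R) (j : nat) : R :=
  if n is m.+1 then p * binexp m F j.+1 + (1 - p) * binexp m F j else F j.

Lemma le_binexp n (F G : nat -> R) j : (forall k, F k <= G k) ->
  binexp n F j <= binexp n G j.
Proof.
move=> FG; elim: n j => [|n IH] j /=; first exact: FG.
have /andP[p0 p1] := p01.
by apply: lerD; rewrite ler_wpM2l ?IH// subr_ge0.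
Qed.

(** The first, second and fourth centered moments, together: centering at
an arbitrary c makes the induction hypothesis apply after one trial. *)
Lemma binexp_quartic n (a b e f c : R) j :
  let v := p * (1 - p) in let y := j%:R + n%:R * p - c in
  binexp n (fun k => a * (k%:R - c) ^+ 4 + b * (k%:R - c) ^+ 2 +
                     e * (k%:R - c) + f) j =
  a * (y ^+ 4 + 6 * n%:R * v * y ^+ 2 + 4 * n%:R * v * (1 - 2 * p) * y +
       n%:R * v * (1 - 6 * v) + 3 * n%:R ^+ 2 * v ^+ 2) +
  b * (y ^+ 2 + n%:R * v) + e * y + f.
Proof.
elim: n j => [|n IH] j /=; first by ring.
by rewrite !IH -!natr1; ring.
Qed.

(** For x < 0 the left-hand side is x (x + 1)^2 (2 - x) <= 0.  Taking
expectations at x = w Y with Y centered bounds P (Y >= 0) from below by moments of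
orders 2 and 4 only. *)
Lemma quartic_le5 (x : R) : 2 * x + 3 * x ^+ 2 - x ^+ 4 <= 5 * (0 <= x)%R%:R.
Proof.
case: (leP 0 x) => x0; rewrite /= ?mulr1 ?mulr0.
  have : 0 <= (x ^+ 2 - 9/5) ^+ 2 + 3/5 * (x - 5/3) ^+ 2.
    by rewrite addr_ge0 ?sqr_ge0// mulr_ge0 ?sqr_ge0// divr_ge0.
  by lra.
have -> : 2 * x + 3 * x ^+ 2 - x ^+ 4 = x * ((x + 1) ^+ 2 * (2 - x)) by ring.
by rewrite mulr_le0_ge0 ?(ltW x0)// mulr_ge0 ?sqr_ge0//; lra.
Qed.

(** If the variance s is at most 7/2, Chebyshev's inequality at distance 2 gives
the bound.  If it is larger, the fourth moment is at most (3 + 2/7) s^2, and the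
quartic test function gives probability at least 1/8 already for exceeding the mean. *)
Lemma binexp_near_mean n :
  8^-1 <= binexp n (fun k => (n%:R * p - 2 <= k%:R)%R%:R) 0.
Proof.
have /andP[p0 p1] := p01; set c := n%:R * p.
set v := p * (1 - p).
have v0 : 0 <= v by rewrite mulr_ge0// subr_ge0.
set s := n%:R * v.
have s0 : 0 <= s by rewrite mulr_ge0.
(* 1 - x^2 / 4 is a lower bound for the indicator of x >= -2. *)
have [s3|s3] := leP s (7/2).
  apply: le_trans (_ : binexp n (fun k => 0 * (k%:R - c) ^+ 4 +
     (- 4^-1) * (k%:R - c) ^+ 2 + 0 * (k%:R - c) + 1) 0 <= _).
    by rewrite binexp_quartic -/v -/c -/s; nra.
  apply: le_binexp => k; case: (leP (c - 2) k%:R) => /= h; last by nra.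
  by have := sqr_ge0 (k%:R - c); lra.
(* w^2 s = 1/2 nearly maximizes 3 w^2 s - w^4 E Y^4. *)
pose w := Num.sqrt (2 * s)^-1.
have w0 : 0 < w by rewrite sqrtr_gt0 invr_gt0; lra.
have w2 : w ^+ 2 * s = 2^-1.
  rewrite sqr_sqrtr ?invr_ge0; last by lra.
  by field; lra.
apply: le_trans (_ : binexp n (fun k => (- w ^+ 4 / 5) * (k%:R - c) ^+ 4 +
     (3 * w ^+ 2 / 5) * (k%:R - c) ^+ 2 + (2 * w / 5) * (k%:R - c) + 0) 0 <= _).
  rewrite binexp_quartic -/v -/c.
  have -> : 0%:R + c - c = 0 by ring.
  rewrite !expr0n /= !mulr0 !addr0 !add0r -/s.
  have -> : 3 * n%:R ^+ 2 * v ^+ 2 = 3 * s ^+ 2 by rewrite /s; ring.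
  have -> : - w ^+ 4 / 5 * (s * (1 - 6 * v) + 3 * s ^+ 2) + 3 * w ^+ 2 / 5 * s =
     - 5^-1 * ((w ^+ 2 * s) * w ^+ 2 * (1 - 6 * v) + 3 * (w ^+ 2 * s) ^+ 2) +
     3 / 5 * (w ^+ 2 * s) by ring.
  rewrite w2; have : w ^+ 2 <= 7^-1.
    by nra.
  by have := sqr_ge0 w; nra.
apply: le_binexp => k.
apply: le_trans (_ : (0 <= w * (k%:R - c))%R%:R <= _).
  by have := quartic_le5 (w * (k%:R - c)); rewrite !exprMn; lra.
rewrite pmulr_rge0// subr_ge0; case: (leP c) => // ck.
by have -> : c - 2 <= k%:R by lra.
Qed.

End binomial.

(** * Traces and counts of a sample *)

Section exchanges.
Variable R : realType.

(** The threshold involves the smaller of the numbers of points inside and outside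
the set among the 2n points, because each of them bounds the variance of b - a under
random exchanges of points between the samples. *)
Definition excess (v : R) (n a b : nat) : bool :=
  (a < b)%N && (v * (minn (a + b) (2 * n - (a + b)))%:R <= (b%:R - a%:R) ^+ 2).

(** Under random exchanges the difference of the counts is a Rademacher sum with
coefficients b i - a i in {-1, 0, 1}, and the sum of their squares is at most both
N and 2n - N.  Both are unaffected by the exchanges, so that the threshold of
[excess] is a constant. *)
Lemma excess_swaps (v : R) n (a b : 'I_n -> bool) : 0 <= v ->
  \sum_(e : {ffun 'I_n -> bool} |
     excess v n (\sum_i (if e i then b i else a i)) (\sum_i (if e i then a i else b i))) 1
  <= 2 ^+ n * expR (- (v / 2)).
Proof.
move=> v0; pose N := (\sum_(i < n) (a i + b i))%N.
pose V := minn N (2 * n - N).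
have eN (e : {ffun 'I_n -> bool}) :
    (\sum_i (if e i then b i else a i) + \sum_i (if e i then a i else b i) = N)%N.
  by rewrite -big_split; apply: eq_bigr => i _; case: (e i); rewrite // addnC.
have eD (e : {ffun 'I_n -> bool}) :
    (\sum_i (if e i then a i else b i))%N%:R - (\sum_i (if e i then b i else a i))%N%:R =
    \sum_i (-1) ^+ e i * ((b i)%:R - (a i)%:R) :> R.
  rewrite !natr_sum -sumrB; apply: eq_bigr => i _.
  by case: (e i); rewrite ?expr1 ?expr0; ring.
have hi (e : {ffun 'I_n -> bool}) : (\sum_i (if e i then a i else b i) <= n)%N.
  rewrite -[leqRHS]card_ord -sum1_card; apply: leq_sum => i _.
  by case: ifP => _; case: (_ i).
(* If V = 0, all points are inside or all are outside, and the counts agree. *)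
have [V0|V0] := posnP V.
  rewrite big_pred0; first by rewrite mulr_ge0 ?expR_ge0 ?exprn_ge0.
  move=> e; apply/negbTE/negP => /andP[lt _]; move: (eN e) (hi e) lt V0; rewrite /V; lia.
have -> : v / 2 = Num.sqrt (v * V%:R) ^+ 2 / (2 * V%:R).
  by rewrite sqr_sqrtr ?mulr_ge0//; field; rewrite pnatr_eq0; lia.
rewrite -[in 2 ^+ n](card_ord n).
apply: le_trans (@rademacher_tail R 'I_n (fun i => (b i)%:R - (a i)%:R) V%:R
  (Num.sqrt (v * V%:R)) _ _ _); last 3 first.
- by rewrite ltr0n.
- have c1 i : ((b i)%:R - (a i)%:R) ^+ 2 <= ((a i + b i)%N%:R : R).
    by case: (a i); case: (b i);
      rewrite /= ?subrr ?sub0r ?subr0 ?sqrrN ?expr1n ?expr0n /= ?addn0 ?add0n ?lexx ?ler0n.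
  have c2 i : ((b i)%:R - (a i)%:R) ^+ 2 <= (2 - (a i + b i)%N%:R : R).
    by case: (a i); case: (b i);
      rewrite /= ?subrr ?sub0r ?subr0 ?sqrrN ?expr1n ?expr0n /= ?addn0 ?add0n; lra.
  have N2 : (N <= 2 * n)%N.
    rewrite mulnC -[X in (X * _)%N]card_ord -sum_nat_const; apply: leq_sum => i _.
    by case: (a i); case: (b i).
  rewrite /V /minn; case: ifP => _.
    by rewrite /N natr_sum; apply: ler_sum.
  rewrite natrB// natrM /N natr_sum mulrC -[X in _ <= X%:R * _ - _](card_ord n).
  rewrite mulr_natl -sumr_const -sumrB.
  exact: ler_sum.
- exact: sqrtr_ge0.
rewrite [leLHS]big_mkcond [leRHS]big_mkcond; apply: ler_sum => e _ /=.
case: ifP => [/andP[lt le]|_]; last by case: ifP => _; rewrite ?ler01.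
rewrite -eD ifT// -(@ger0_norm _ (_ - _)); last by rewrite subr_ge0 ler_nat ltnW.
by rewrite -sqrtr_sqr ler_wsqrtr//; move: le; rewrite (eN e).
Qed.

End exchanges.

Section traces.
Context d (T : measurableType d) (R : realType).
Implicit Types (SS : set (set T)) (S : set T) (P : probability T R).

Definition trace n S (z : n.-tuple T) : {set 'I_n} :=
  [set i | `[< S (tnth z i) >]]%SET.

Definition count_in n S (z : n.-tuple T) : nat := \sum_(i < n) `[< S (tnth z i) >].

Definition traces n SS (z : n.-tuple T) : {set {set 'I_n}} :=
  [set B | `[< exists2 S, SS S & trace S z = B >]]%SET.

Lemma traceP n S (z : n.-tuple T) (B : {set 'I_n}) :
  (forall i, S (tnth z i) <-> i \in B) <-> trace S z = B.
Proof.
split=> [h|<- i]; last by rewrite inE; split=> [/asboolP|/asboolP].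
by apply/setP => i; rewrite inE; apply/asboolP/idP => /h.
Qed.

Lemma count_inE n S (z : n.-tuple T) : count_in S z = #|trace S z|.
Proof.
rewrite -sum1_card big_mkcond; apply: eq_bigr => i _; rewrite inE.
by case: asboolP.
Qed.

Lemma count_in_le n S (z : n.-tuple T) : (count_in S z <= n)%N.
Proof. by rewrite count_inE -[leqRHS]card_ord max_card. Qed.

Lemma empiricalE n S (z : n.-tuple T) :
  empirical R z S = (count_in S z)%:R / n%:R.
Proof.
congr (_ / _); rewrite /count_in natr_sum; apply: eq_bigr => i _.
by rewrite indicE -[LHS]/((asbool _)%:R).
Qed.

(** There are finitely many traces on n points. *)
Lemma measurable_trace_event SS n (G : pred {set 'I_n}) : measurable_traces SS ->
  measurable [set z : n.-tuple T | exists2 S, SS S & G (trace S z)].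
Proof.
move=> mt; have -> : [set z : n.-tuple T | exists2 S, SS S & G (trace S z)] =
    \bigcup_(B in [set B | G B]) [set z : n.-tuple T |
      exists2 S, SS S & forall i, S (tnth z i) <-> i \in B].
  apply/seteqP; split=> z /=.
    by move=> [S SSS GS]; exists (trace S z) => //=; exists S => //; apply/traceP.
  by move=> [B /= GB [S SSS /traceP e]]; exists S => //; rewrite e.
by apply: fin_bigcup_measurable => [|B _]; [exact: finite_finset|exact: mt].
Qed.

Lemma measurable_traces1 S : measurable S -> measurable_traces [set S].
Proof.
move=> mS k B; have -> : [set z : k.-tuple T |
    exists2 S', [set S] S' & forall i, S' (tnth z i) <-> i \in B] =
    box (fun i => if i \in B then S else ~` S).
  apply/seteqP; split=> z /=.
    by move=> [_ -> h] i; case: ifPn => [/h//|/negP + /h].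
  move=> h; exists S => // i; move: (h i); case: (i \in B) => Si; first by split.
  by split=> // /Si.
by apply: measurable_box => i; case: ifP => // _; exact: measurableC.
Qed.

(** The event depends on the trace of S only, so it is a trace event of the class
whose single element is S. *)
Lemma measurable_count_in S n (E : pred nat) : measurable S ->
  measurable [set z : n.-tuple T | E (count_in S z)].
Proof.
move=> mS; have := measurable_trace_event (fun B : {set 'I_n} => E #|B|) (measurable_traces1 mS).
congr measurable; apply/seteqP; split=> z /=; first by move=> [_ ->]; rewrite -count_inE.
by rewrite count_inE; exists S.
Qed.

(** Conditioning on the first point gives one step of [binexp]. *)
Lemma power_count_in P S n (E : pred nat) j : measurable S ->
  power P n [set z | E (count_in S z + j)%N] =
  (binexp (fine (P S)) n (fun k => (E k)%:R) j)%:E.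
Proof.
move=> mS; elim: n j => [|n IH] j.
  have c0 (z : 0.-tuple T) : count_in S z = 0%N by rewrite /count_in big_ord0.
  rewrite /= diracE; case: (boolP (E j)) => Ej.
    by rewrite mem_set//= c0.
  by rewrite memNset//= c0; exact/negP.
have cc (x : T) (z : n.-tuple T) : count_in S (cons_pair (x, z)) = (`[< S x >] + count_in S z)%N.
  rewrite /count_in big_ord_recl /= tnth0; congr (_ + _)%N.
  by apply: eq_bigr => i _; rewrite tnthS.
transitivity ((P \x power P n)%E (S `*` [set z : n.-tuple T | E (count_in S z + j.+1)%N] `|`
    (~` S) `*` [set z : n.-tuple T | E (count_in S z + j)%N])).
  rewrite /= /distribution /pushforward; congr ((_ \x _)%E _).
  apply/seteqP; split=> [[x z]|[x z]] /=; rewrite cc.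
    case: asboolP => Sx; first by rewrite add1n addSnnS; left.
    by rewrite add0n; right.
  by move=> [[Sx]|[Sx]]; case: asboolP => //= _; rewrite ?add1n ?add0n ?addSnnS.
have mE i : measurable [set z : n.-tuple T | E (count_in S z + i)%N].
  exact: (@measurable_count_in S n (fun k => E (k + i)%N)).
rewrite measureU; last first.
- by apply/seteqP; split=> // -[x z] /= [[Sx _] [nSx _]].
- by apply: measurableX => //; exact: measurableC.
- exact: measurableX.
rewrite [X in (X + _)%E](@product_measure1E _ _ _ _ _ P (power P n))//.
rewrite [X in (_ + X)%E](@product_measure1E _ _ _ _ _ P (power P n))//; last exact: measurableC.
rewrite [X in (_ * X + _)%E]IH [X in (_ + _ * X)%E]IH [X in (_ + X * _)%E]probability_setC//.
set q := fine (P S); have e : P S = q%:E by rewrite /q fineK ?fin_num_measure.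
by rewrite e [X in (X * _ + _)%E]e -EFinB -!EFinM -EFinD.
Qed.

End traces.

(** * Symmetrization by a ghost sample *)

Section symmetrization.
Context d (T : measurableType d) (R : realType).
Implicit Types (SS : set (set T)) (S : set T) (P : probability T R).

Lemma fine_prob01 P S : measurable S -> 0 <= fine (P S) <= 1.
Proof.
move=> mS; rewrite fine_ge0//= -lee_fin fineK ?fin_num_measure//.
exact: probability_le1.
Qed.

(** The slack 2 is what makes the constant 1/8 valid for all n and all
probabilities of S, including those of order 1 / n. *)
Lemma count_in_near_mean P S n : measurable S ->
  ((8^-1)%:E <= power P n [set z | (n%:R * fine (P S) - 2 <= (count_in S z)%:R)%R])%E.
Proof.
move=> mS; set p := fine (P S).
have p01 : 0 <= p <= 1 by exact: fine_prob01.
have := power_count_in P n (fun k : nat => n%:R * p - 2 <= k%:R) 0 mS.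
under eq_set do rewrite addn0.
by move=> ->; rewrite lee_fin; exact: binexp_near_mean.
Qed.

(** The first and the second half of the 2n points play the roles of the sample
and of the ghost sample. *)
Definition ghost SS (v : R) n : set ((n + n).-tuple T) :=
  [set z | exists2 S, SS S &
     excess v n (\sum_(i < n) `[< S (tnth z (lshift n i)) >])
                (\sum_(i < n) `[< S (tnth z (rshift n i)) >])].

Arguments ghost SS v n _ : clear implicits.

Lemma measurable_ghost SS v n : measurable_traces SS -> measurable (ghost SS v n).
Proof.
move=> /(@measurable_trace_event _ _ _ (n + n) (fun B : {set 'I_(n + n)} =>
  excess v n (\sum_(i < n) (lshift n i \in B)) (\sum_(i < n) (rshift n i \in B)))).
congr measurable; apply/seteqP; split=> z /= -[S SSS h]; exists S => //.
  by move: h; under eq_bigr do rewrite inE; under [X in excess _ _ _ X]eq_bigr do rewrite inE.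
by under eq_bigr do rewrite inE; under [X in excess _ _ _ X]eq_bigr do rewrite inE.
Qed.

Lemma tnth_swap_l n (e : {ffun 'I_n -> bool}) (z : n.-tuple T * n.-tuple T) i :
  tnth (swap e z) (lshift n i) = tnth (if e i then z.2 else z.1) i.
Proof. by rewrite tnth_mktuple (unsplitK (inl i)). Qed.

Lemma tnth_swap_r n (e : {ffun 'I_n -> bool}) (z : n.-tuple T * n.-tuple T) i :
  tnth (swap e z) (rshift n i) = tnth (if e i then z.1 else z.2) i.
Proof. by rewrite tnth_mktuple (unsplitK (inr i)). Qed.

(** Union bound over the traces on the 2n points, which are the same up to a
relabelling before and after the exchanges. *)
Lemma ghost_swaps SS v n (z : n.-tuple T * n.-tuple T) : 0 <= v ->
  \sum_(e : {ffun 'I_n -> bool}) \1_(ghost SS v n) (swap e z) <=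
  #|traces SS (swap [ffun => false] z)|%:R * (2 ^+ n * expR (- (v / 2))) :> R.
Proof.
move=> v0; set z0 := swap [ffun => false] z.
pose ex (B : {set 'I_(n + n)}) (e : {ffun 'I_n -> bool}) :=
  excess v n (\sum_i (if e i then rshift n i \in B else lshift n i \in B))
             (\sum_i (if e i then lshift n i \in B else rshift n i \in B)).
apply: le_trans (_ : \sum_(e : {ffun 'I_n -> bool})
    \sum_(B in traces SS z0) (ex B e)%:R <= _).
  apply: ler_sum => e _; rewrite indicE; case: (boolP (_ \in _)) => [|_]; last first.
    by apply: sumr_ge0 => B _; rewrite ler0n.
  rewrite inE => -[S SSS h].
  rewrite (bigD1 (trace S z0)) /=; last by rewrite inE; apply/asboolP; exists S.
  rewrite (_ : ex _ e) ?lerDl ?sumr_ge0//.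
  move: h; rewrite /ex; congr (excess _ _ _ _); apply: eq_bigr => i _;
    rewrite !inE !tnth_swap_l !tnth_swap_r !ffunE; by case: (e i).
rewrite exchange_big /= -sum1_card natr_sum mulr_suml; apply: ler_sum => B _; rewrite mul1r.
apply: le_trans (excess_swaps (fun i => lshift n i \in B) (fun i => rshift n i \in B) v0).
rewrite [leRHS]big_mkcond le_eqVlt; apply/orP; left; apply/eqP.
by apply: eq_bigr => e _; rewrite /ex; case: (excess _ _ _ _).
Qed.

(** All the exchanges give the event the same probability, so this probability is
the integral of the proportion of exchanges that realize the event. *)
Lemma ghost_prob P SS v n (K : R) : 0 <= v -> measurable_traces SS ->
  (forall z : (n + n).-tuple T, #|traces SS z|%:R <= K) ->
  (power P (n + n) (ghost SS v n) <= (K * expR (- (v / 2)))%:E)%E.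
Proof.
move=> v0 mt cK; set D := ghost SS v n.
have mD : measurable D by exact: measurable_ghost.
set M := (power P n \x power P n)%E.
set m := power P (n + n) D.
have mf : m \is a fin_num by rewrite fin_num_measure.
have mS (e : {ffun 'I_n -> bool}) : measurable (swap e @^-1` D).
  by rewrite -[X in measurable X]setTI; exact: measurable_swap.
have step : ((2 ^+ n)%:E * m <= (2 ^+ n * (K * expR (- (v / 2))))%:E)%E.
  have -> : ((2 ^+ n)%:E * m = \sum_(e : {ffun 'I_n -> bool}) M (swap e @^-1` D))%E.
    rewrite (eq_bigr (fun _ => m)); last by move=> e _; exact: power_swap.
    rewrite -(fineK mf) sumEFin sumr_const -EFinM; congr EFin.
    by rewrite card_ffun card_bool card_ord -[RHS]mulr_natl natrX.
  rewrite (eq_bigr (fun e => \int[M]_x (\1_(swap e @^-1` D) x)%:E)%E); last first.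
    by move=> e _; rewrite integral_indic// setIT.
  rewrite -ge0_integral_sum//; last first.
    by move=> e; apply/measurable_EFinP; exact: measurable_indic.
  apply: (@le_trans _ _ (\int[M]_x (2 ^+ n * (K * expR (- (v / 2))))%:E)%E).
    apply: ge0_le_integral => //.
    - by move=> z _; apply: sume_ge0.
    - by apply: emeasurable_sum => e; apply/measurable_EFinP; exact: measurable_indic.
    move=> z _; rewrite sumEFin lee_fin.
    apply: le_trans (ghost_swaps SS z v0) _.
    by rewrite mulrCA ler_wpM2l ?exprn_ge0// ler_wpM2r// expR_ge0.
  by rewrite integral_cst// [X in (_ * X)%E]probability_setT mule1.
move: step; rewrite -(fineK mf) -EFinM !lee_fin ler_pM2l//.
Qed.

(** The event [bad] refers to the unknown values P S and may fail to be
measurable.  It is enclosed in the measurable set of the samples x for which a ghost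
sample produces an excess with probability at least 1/8; Markov's inequality and
Fubini's theorem bound the probability of this set by 8 times that of an excess. *)
Lemma symmetrization P SS v n (K : R) (bad : set (n.-tuple T)) :
  0 <= v -> SS `<=` measurable -> measurable_traces SS ->
  (forall z : (n + n).-tuple T, #|traces SS z|%:R <= K) ->
  (forall x, bad x -> exists2 S, SS S & forall b, (b <= n)%N ->
     n%:R * fine (P S) - 2 <= b%:R -> excess v n (count_in S x) b) ->
  exists A, [/\ measurable A, bad `<=` A &
    (power P n A <= (8 * K * expR (- (v / 2)))%:E)%E].
Proof.
move=> v0 mSS mt cK hbad.
pose e0 : {ffun 'I_n -> bool} := [ffun => false].
pose D := swap e0 @^-1` ghost SS v n.
have mg : measurable (ghost SS v n) by exact: measurable_ghost.
have mD : measurable D by rewrite -[X in measurable X]setTI; exact: measurable_swap.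
pose f x := power P n (xsection D x).
have mf : measurable_fun setT f by exact: measurable_fun_xsection.
pose A := [set x | ((8^-1)%:E <= f x)%E].
have mA : measurable A.
  by rewrite -[X in measurable X]setTI; exact: emeasurable_fun_c_infty.
exists A; split => //.
- move=> x /hbad[S SSS hS]; apply: le_trans (count_in_near_mean P n (mSS _ SSS)) _.
  apply: le_measure; rewrite ?inE.
  + exact: (@measurable_count_in _ _ S n
      (fun k : nat => n%:R * fine (P S) - 2 <= k%:R) (mSS _ SSS)).
  + exact: measurable_xsection.
  move=> y /= hy; apply/xsectionP; exists S => //.
  have := hS _ (count_in_le S y) hy; congr (excess _ _ _ _);
    by apply: eq_bigr => i _; rewrite ?tnth_swap_l ?tnth_swap_r ffunE.
have : ((8^-1)%:E * power P n A <= (K * expR (- (v / 2)))%:E)%E.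
  apply: le_trans (ghost_prob P v0 mt cK).
  rewrite -(power_swap P e0 mg) -integral_cst//.
  apply: (@le_trans _ _ (\int[power P n]_(x in A) f x)%E).
    apply: ge0_le_integral => //; first by move=> x _; rewrite lee_fin.
    exact: measurable_funTS.
  apply: ge0_subset_integral => //.
have fA : power P n A \is a fin_num by rewrite fin_num_measure.
rewrite -(fineK fA) -EFinM !lee_fin -mulrA => h.
by rewrite -(@ler_pM2l _ 8^-1)// mulKf.
Qed.

End symmetrization.

(** * Vapnik-Chervonenkis dimension and number of traces *)

Section vc_dimension.
Context d (T : measurableType d) (R : realType).
Implicit Types (SS : set (set T)) (A : set T).

Lemma VC_ge SS A k : (VC R SS < +oo)%E -> (A #= `I_k)%card -> shatters SS A ->
  k%:R <= fine (VC R SS).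
Proof.
move=> Voo Ak sA.
have kV : (k%:R%:E <= VC R SS)%E.
  by apply: ereal_sup_ubound; exists k => //; exists A.
rewrite -lee_fin fineK// fin_numElt Voo andbT.
by apply: lt_le_trans kV; rewrite ltNyr.
Qed.

Lemma fine_VC_ge0 SS : (VC R SS < +oo)%E -> 0 <= fine (VC R SS).
Proof.
move=> Voo; have [[S SSS]|nS] := pselect (exists S, SS S).
  apply: (@VC_ge SS set0 0) => //; first by rewrite II0.
  by move=> B; rewrite subset0 => ->; exists S; rewrite ?set0I.
rewrite /VC (_ : [set _ | _ in _] = set0) ?ereal_sup0//.
apply/seteqP; split => // _ /= [k [A _ sA] _].
by apply: nS; have [S SSS _] := sA set0 (sub0set _); exists S.
Qed.

(** The uniform bound is needed for the sets S under P and for their complements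
under Q. *)
Definition complements SS : set (set T) := [set ~` S | S in SS].

(** The complement of S cuts out B on A when S cuts out A minus B. *)
Lemma shatters_complements SS A : shatters SS A -> shatters (complements SS) A.
Proof.
move=> sA B BA; have [S SSS e] := sA (A `\` B) (@subDsetl _ _ _).
exists (~` S); first by exists S.
apply/seteqP; split=> x /=.
  move=> [Ax nSx]; apply: contrapT => nBx.
  have : (A `\` B) x by [].
  by rewrite -e => -[].
move=> Bx; split; first exact: BA.
move=> Sx; have : (A `&` S) x by split=> //; exact: BA.
by rewrite e => -[].
Qed.

Lemma complementsK SS : complements (complements SS) = SS.
Proof.
apply/seteqP; split=> S /=; first by move=> [_ [S' SS' <-] <-]; rewrite setCK.
by move=> SSS; exists (~` S); rewrite ?setCK//; exists S.
Qed.

Lemma VC_complements SS : VC R (complements SS) = VC R SS.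
Proof.
congr ereal_sup; apply/seteqP; split=> _ /= [k [A Ak sA] <-]; exists k => //; exists A => //.
  by rewrite -(complementsK SS); exact: shatters_complements.
exact: shatters_complements.
Qed.

Lemma measurable_traces_complements SS :
  measurable_traces SS -> measurable_traces (complements SS).
Proof.
move=> mt k B; have := mt k (~: B)%SET; congr measurable.
apply/seteqP; split=> z /=.
  move=> [S SSS h]; exists (~` S); first by exists S.
  move=> i; have := h i; rewrite finset.in_setC /= => -[h1 h2]; split.
    by move=> nS; apply: contrapT => /negP /h2.
  by move=> iB /h1; rewrite iB.
move=> [_ [S SSS <-] h]; exists S => // i.
have [h1 h2] := h i; rewrite finset.in_setC; split.
  by move=> Si; apply/negP => /h2.
by move=> /negP iB; apply: contrapT => /h1.
Qed.

(** The points of z indexed by a shattered set of indices are distinct, because two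
equal points cannot be told apart by a trace; so they form a set of the same
cardinal, shattered by the class. *)
Lemma fshatters_card SS m (z : m.-tuple T) (A : {set 'I_m}) : (VC R SS < +oo)%E ->
  fshatters (traces SS z) A -> (#|A|%:R <= fine (VC R SS)).
Proof.
move=> Voo /fshattersP sA.
have inj : {in A &, injective (tnth z)}.
  move=> i j iA jA e; apply/eqP; apply: contrapT => /negP ij.
  have [|B] := sA [set i]%SET; first by rewrite finset.sub1set.
  rewrite inE => /asboolP[S _ <-] eB.
  have : i \in (A :&: trace S z)%SET by rewrite eB finset.in_set1.
  rewrite !inE => /andP[_ Si].
  have : j \in (A :&: trace S z)%SET by rewrite !inE jA -e.
  by rewrite eB finset.in_set1 eq_sym (negbTE ij).
pose f k := nth point [seq tnth z i | i <- enum A] k.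
have fE k : (k < #|A|)%N -> exists2 i, i \in A & f k = tnth z i.
  move=> kA; have i0 : 'I_m by case: (enum A) (cardE A) kA => [->|].
  exists (nth i0 (enum A) k); first by rewrite -mem_enum mem_nth// -cardE.
  by rewrite /f (nth_map i0)// -cardE.
apply: (@VC_ge SS (f @` `I_#|A|)) => //.
  apply: inj_card_eq => j k; rewrite !inE /= => jA kA /eqP.
  rewrite /f nth_uniq ?size_map -?cardE//; first by move/eqP.
  rewrite map_inj_in_uniq ?enum_uniq// => x y; rewrite !mem_enum; exact: inj.
move=> B BA.
have [|C] := sA [set i in A | `[< B (tnth z i) >]]%SET.
  by apply/fintype.subsetP => i; rewrite inE => /andP[].
rewrite inE => /asboolP[S SSS <-] e; exists S => //.
apply/seteqP; split=> x.
  move=> [[k /= kA <-]]; have [i iA ->] := fE k kA => Si.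
  have : i \in (A :&: trace S z)%SET by rewrite !inE iA; apply/asboolP.
  by rewrite e inE iA => /asboolP.
move=> Bx; split; first exact: BA.
have [k /= kA fk] := BA _ Bx; have [i iA fi] := fE k kA.
have : i \in (A :&: trace S z)%SET by rewrite e inE iA -fi fk; apply/asboolP.
by rewrite !inE -fi fk => /andP[_ /asboolP].
Qed.

(** The number of traces is at most m ^ k + 1 with k the integer part of the
dimension, and both terms are at most m to the dimension. *)
Lemma card_traces_le SS m (z : m.-tuple T) : (2 <= m)%N -> (VC R SS < +oo)%E ->
  #|traces SS z|%:R <= 2 * expR (fine (VC R SS) * ln m%:R).
Proof.
move=> m2 Voo; set V := fine (VC R SS).
have V0 : 0 <= V by exact: fine_VC_ge0.
pose k := Num.truncn V.
have kV : k%:R <= V by rewrite truncn_le.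
have : (#|traces SS z| <= m ^ k + 1)%N.
  apply: leq_trans (sum_bin_le k m2).
  rewrite (eq_bigr (fun i : 'I_k.+1 => 'C(#|'I_m|, i))) -?card_small_sets;
    last by move=> i _; rewrite card_ord.
  apply: leq_trans (card_le_shattered _) _.
  apply/subset_leq_card/fintype.subsetP => A; rewrite !inE => sA.
  by rewrite truncn_ge_nat//; exact: (fshatters_card Voo sA).
rewrite -(ler_nat R) => /le_trans; apply.
have mk : m%:R ^+ k <= expR (V * ln m%:R) :> R.
  rewrite -[m%:R in leLHS]lnK ?posrE ?ltr0n; last by lia.
  rewrite -expRM_natl ler_expR ler_wpM2r// ln_ge0// ler1n; lia.
rewrite natrD natrX mulr_natl mulr2n; apply: lerD => //.
by rewrite -[leLHS]expR0 ler_expR mulr_ge0// ln_ge0// ler1n; lia.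
Qed.

End vc_dimension.

(** * From a deviation to an excess over the ghost sample *)

Section deviation.
Variable R : realType.
Implicit Types t g x y p : R.

(** From exp (-1/4) >= 3/4 follows exp 3 <= (4/3)^12 <= 32. *)
Lemma ln32_ge3 : 3 <= ln 32 :> R.
Proof.
rewrite -[leLHS]expRK ler_ln ?posrE ?expR_gt0//.
have -> : 3 = 12%:R * 4^-1 :> R by field.
have e4 : expR 4^-1 <= 4 / 3 :> R.
  have := expR_ge1Dx (- 4^-1 : R); rewrite expRN => h.
  have e0 : 0 < expR (4^-1 : R) by exact: expR_gt0.
  have : 3 / 4 * expR 4^-1 <= (expR 4^-1)^-1 * expR 4^-1 :> R.
    by rewrite ler_pM2r//; lra.
  by rewrite mulVf ?gt_eqF//; lra.
rewrite expRM_natl; apply: le_trans (_ : (4 / 3) ^+ 12 <= _).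
  by apply: lerXn2r => //; rewrite ?nnegrE ?expR_ge0// divr_ge0.
by rewrite expr_div_n ler_pdivrMr; [lra|rewrite exprn_gt0].
Qed.

(** The value of [Vfun] on [0, 1], without truncation. *)
Definition spread x := Num.min x (1 - x).

Lemma VfunE x : x <= 1 -> Vfun x = spread x.
Proof. by move=> x1; rewrite /Vfun /spread max_l// subr_ge0. Qed.

Lemma spread_ge0 x : 0 <= x <= 1 -> 0 <= spread x.
Proof. by move=> /andP[x0 x1]; rewrite le_min x0 subr_ge0. Qed.

(** Here x and y are the frequencies in the sample and in the ghost sample, and p
is the probability.  The bound y - x >= sqrt (t * spread x) + 5/6 t suffices: for
x <= 1/2 compare with x + y, where the terms linear in y - x are absorbed by
5/6 t > t / 2, and otherwise with 2 - (x + y) <= 2 (1 - x). *)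
Lemma ghost_above t g x y p : 0 <= x <= 1 -> 0 < t -> 0 <= g -> 6 * g <= t ->
  x + Num.sqrt (t * spread x) + t < p -> p - g <= y ->
  x < y /\ t / 2 * Num.min (x + y) (2 - (x + y)) <= (y - x) ^+ 2.
Proof.
move=> x01 t0 g0 gt xp py.
set s := Num.sqrt (t * spread x).
have s0 : 0 <= s by exact: sqrtr_ge0.
have s2 : s ^+ 2 = t * spread x.
  by rewrite sqr_sqrtr// mulr_ge0 ?(ltW t0)//; exact: spread_ge0.
split; first by move: xp; rewrite -/s; lra.
have e : s + 5/6 * t <= y - x by move: xp; rewrite -/s; lra.
have [xl|xl] := leP x (1 - x).
  have sx : spread x = x by rewrite /spread min_l.
  apply: le_trans (_ : t / 2 * (x + y) <= _).
    by rewrite ler_wpM2l ?ge_min ?lexx// ltW// divr_gt0.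
  rewrite sx in s2; nra.
have sx : spread x = 1 - x by rewrite /spread min_r// ltW.
apply: le_trans (_ : t / 2 * (2 - (x + y)) <= _).
  by rewrite ler_wpM2l ?ge_min ?lexx ?orbT// ltW// divr_gt0.
by rewrite sx in s2; nra.
Qed.

(** The mirror image of [ghost_above], except that the spread is taken at the
probability p and not at the frequency x; the condition 6 g <= t leaves enough room
to replace p by p + g. *)
Lemma ghost_below t g x y p : 0 <= p <= 1 -> 0 < t -> 0 <= g -> 6 * g <= t ->
  p + Num.sqrt (t * spread p) + t < x -> y <= p + g ->
  y < x /\ t / 2 * Num.min (x + y) (2 - (x + y)) <= (x - y) ^+ 2.
Proof.
move=> p01 t0 g0 gt px yp.
set s := Num.sqrt (t * spread p).
have s0 : 0 <= s by exact: sqrtr_ge0.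
have s2 : s ^+ 2 = t * spread p.
  by rewrite sqr_sqrtr// mulr_ge0 ?(ltW t0)//; exact: spread_ge0.
rewrite -/s in px; have /andP[p0 p1] := p01.
split; first by lra.
have e : s + 5/6 * t <= x - y by lra.
have h1 : 0 <= ((x - y) - (s + 5/6 * t)) * ((x - y) + (s + t / 3)).
  by apply: mulr_ge0; lra.
have h2 : 0 <= t * (x - p - s - t) by apply: mulr_ge0; lra.
have h3 : 0 <= s * t by apply: mulr_ge0; lra.
have h4 : 0 <= t * (p + g - y) by apply: mulr_ge0; lra.
have h5 : 0 <= t * (t - 6 * g) by apply: mulr_ge0; lra.
have [pl|pl] := leP p (1 - p).
  have sp : spread p = p by rewrite /spread min_l.
  apply: le_trans (_ : t / 2 * (x + y) <= _).
    by rewrite ler_wpM2l ?ge_min ?lexx// ltW// divr_gt0.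
  by rewrite sp in s2; nra.
have sp : spread p = 1 - p by rewrite /spread min_r// ltW.
apply: le_trans (_ : t / 2 * (2 - (x + y)) <= _).
  by rewrite ler_wpM2l ?ge_min ?lexx ?orbT// ltW// divr_gt0.
by rewrite sp in s2; nra.
Qed.

Lemma excess_rescale t n a b : (0 < n)%N -> (a <= n)%N -> (b <= n)%N ->
  (a%:R / n%:R < b%:R / n%:R :> R) ->
  t / 2 * Num.min (a%:R / n%:R + b%:R / n%:R) (2 - (a%:R / n%:R + b%:R / n%:R)) <=
    (b%:R / n%:R - a%:R / n%:R) ^+ 2 ->
  excess (n%:R * t / 2) n a b.
Proof.
move=> n0 an bn ab h; have n0' : 0 < n%:R :> R by rewrite ltr0n.
have n1 : n%:R != 0 :> R by rewrite gt_eqF.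
apply/andP; split; first by rewrite -(ltr_nat R) -(ltr_pM2r (x := n%:R^-1)) ?invr_gt0.
have -> : (minn (a + b) (2 * n - (a + b)))%:R =
   n%:R * Num.min (a%:R / n%:R + b%:R / n%:R) (2 - (a%:R / n%:R + b%:R / n%:R)) :> R.
  rewrite minr_pMr ?ltW//.
  have ab2 : (a + b <= 2 * n)%N by lia.
  rewrite natr_min natrB// natrM natrD.
  by congr Num.min; field.
have -> : b%:R - a%:R = n%:R * (b%:R / n%:R - a%:R / n%:R) :> R by field.
rewrite exprMn [leLHS](_ : _ = n%:R ^+ 2 *
  (t / 2 * Num.min (a%:R / n%:R + b%:R / n%:R) (2 - (a%:R / n%:R + b%:R / n%:R)))); last by ring.
by rewrite ler_wpM2l ?sqr_ge0.
Qed.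

End deviation.

(** * Deviation of empirical frequencies *)

Section deviation_bounds.
Context d (T : measurableType d) (R : realType).
Variables (SS : set (set T)) (n : nat) (delta : R).
Hypothesis delta01 : 0 < delta < 1.
Hypothesis n0 : (0 < n)%N.
Hypothesis VCoo : (VC R SS < +oo)%E.
Implicit Types (S : set T) (P : probability T R).

Local Notation t := (tau SS n delta).
Local Notation h := (hplus SS n delta).
Local Notation VL := (fine (VC R SS) * ln (2 * n%:R)).

Let nR0 : 0 < n%:R :> R. Proof. by rewrite ltr0n. Qed.

Lemma VL_ge0 : 0 <= VL.
Proof.
rewrite mulr_ge0 ?fine_VC_ge0// ln_ge0// -natrM ler1n; lia.
Qed.

Lemma n_tau : n%:R * t = 4 * (VL + ln (32 / delta)).
Proof. by rewrite /tau mulrC divfK// gt_eqF. Qed.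

(** This is where the constant 32 makes t large compared with 2 / n. *)
Lemma n_tau_ge : 12 <= n%:R * t.
Proof.
rewrite n_tau; have /andP[d0 d1] := delta01.
have : ln 32 <= ln (32 / delta).
  by rewrite ler_ln ?posrE ?divr_gt0// ler_pdivlMr//; lra.
by have := ln32_ge3 R; have := VL_ge0; lra.
Qed.

Lemma tau_gt0 : 0 < t.
Proof. by rewrite -(pmulr_rgt0 _ nR0); have := n_tau_ge; lra. Qed.

Lemma ghost_slack : 6 * (2 / n%:R) <= t.
Proof. by rewrite mulrA ler_pdivrMr// mulrC; have := n_tau_ge; lra. Qed.

Lemma expR_tau : expR (- (n%:R * t / 2 / 2)) = expR (- VL) * delta / 32.
Proof.
have /andP[d0 d1] := delta01.
have -> : - (n%:R * t / 2 / 2) = - VL - ln (32 / delta) by rewrite n_tau; field.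
rewrite expRD -mulrA; congr (_ * _); rewrite expRN lnK ?posrE ?divr_gt0//.
by rewrite invf_div.
Qed.

Lemma ratio01 a : (a <= n)%N -> 0 <= (a%:R / n%:R : R) <= 1.
Proof. by move=> an; rewrite divr_ge0//= ler_pdivrMr// mul1r ler_nat. Qed.

Lemma hplus_lt x p : x <= 1 -> p <= 1 -> h x < p -> x + Num.sqrt (t * spread x) + t < p.
Proof. by move=> x1 p1; rewrite /hplus VfunE// gt_min => /orP[//|]; lra. Qed.

(** The failure probability is 8 * 2 * (2n)^VC * exp (- n tau / 4) = delta / 2. *)
Lemma uniform_upper_bound P : SS `<=` measurable -> measurable_traces SS ->
  exists A, [/\ measurable A, (power P n A <= (delta / 2)%:E)%E &
    forall x, ~ A x -> forall S, SS S -> fine (P S) <= h (empirical R x S)].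
Proof.
move=> mSS mt.
pose bad := [set x : n.-tuple T | exists2 S, SS S & h (empirical R x S) < fine (P S)].
have [|z||A [mA badA PA]] := @symmetrization _ _ _ P SS (n%:R * t / 2) n
    (2 * expR VL) bad _ mSS mt.
- by have := n_tau_ge; lra.
- rewrite -natrM mul2n -addnn; apply: card_traces_le => //; lia.
- move=> x [S SSS]; rewrite empiricalE => hx; exists S => // b bn pb.
  have an := count_in_le S x.
  have /andP[p0 p1] := fine_prob01 P (mSS _ SSS).
  have /andP[a0 a1] := ratio01 an.
  have [] := @ghost_above _ t (2 / n%:R) ((count_in S x)%:R / n%:R) (b%:R / n%:R) (fine (P S)).
  + by rewrite a0.
  + exact: tau_gt0.
  + by rewrite divr_ge0.
  + exact: ghost_slack.
  + exact: hplus_lt.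
  + by rewrite -(ler_pM2l nR0) mulrBr ![n%:R * (_ / _)]mulrC !divfK ?gt_eqF.
  exact: excess_rescale.
exists A; split=> //.
- apply: le_trans PA _; rewrite lee_fin expR_tau le_eqVlt; apply/orP; left; apply/eqP.
  by rewrite expRN; field; rewrite gt_eqF// expR_gt0.
- move=> x nAx S SSS; rewrite leNgt; apply/negP => hx; apply: nAx.
  by apply: badA; exists S.
Qed.

(** A frequency of S far above its probability is a frequency of the complement far
below its probability, and the class made of this complement has one trace. *)
Lemma single_lower_bound P S : measurable S ->
  exists A, [/\ measurable A, (power P n A <= (delta / 2)%:E)%E &
    forall x, ~ A x -> empirical R x S <= h (fine (P S))].
Proof.
move=> mS; have mC : measurable (~` S) by exact: measurableC.
pose bad := [set x : n.-tuple T | h (fine (P S)) < empirical R x S].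
have PC : fine (P (~` S)) = 1 - fine (P S).
  by rewrite probability_setC// -(fineK (fin_num_measure P _ mS)).
have /andP[p0 p1] := fine_prob01 P mS.
have [||z||A [mA badA PA]] := @symmetrization _ _ _ P [set ~` S] (n%:R * t / 2) n
    1 bad _ _ (measurable_traces1 mC).
- by have := n_tau_ge; lra.
- by move=> _ ->.
- rewrite lern1 -(finset.cards1 (trace (~` S) z)); apply/subset_leq_card.
  apply/fintype.subsetP => B; rewrite inE => /asboolP[_ -> <-].
  by rewrite finset.in_set1.
- move=> x; rewrite /bad /= empiricalE => hx; exists (~` S) => // b bn pb.
  have an := count_in_le S x.
  have cC : (count_in (~` S) x + count_in S x = n)%N.
    rewrite /count_in -big_split /= -[RHS]card_ord -sum1_card.
    by apply: eq_bigr => i _; rewrite asbool_neg; case: asboolP.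
  have /andP[a0 a1] := ratio01 an.
  have eb : b%:R / n%:R = 1 - (n - b)%N%:R / n%:R :> R.
    by rewrite natrB//; field; rewrite gt_eqF.
  have ea : (count_in (~` S) x)%:R / n%:R = 1 - (count_in S x)%:R / n%:R :> R.
    have <- : (count_in (~` S) x)%:R + (count_in S x)%:R = n%:R :> R by rewrite -natrD cC.
    by field; rewrite -natrD cC gt_eqF.
  have [] := @ghost_below _ t (2 / n%:R) ((count_in S x)%:R / n%:R)
    ((n - b)%N%:R / n%:R) (fine (P S)).
  + by rewrite p0.
  + exact: tau_gt0.
  + by rewrite divr_ge0.
  + exact: ghost_slack.
  + exact: hplus_lt.
  + rewrite -lerBlDl -(ler_pM2l nR0) mulrBr ![n%:R * (_ / _)]mulrC !divfK ?gt_eqF//.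
    by rewrite natrB//; move: pb; rewrite PC; lra.
  move=> yx le; apply: excess_rescale => //.
  - exact: count_in_le.
  - by rewrite ea eb; lra.
  rewrite ea eb; set X := (count_in S x)%:R / _ in yx le *; set Y := (n - b)%N%:R / _ in yx le *.
  have -> : 1 - X + (1 - Y) = 2 - (X + Y) by ring.
  have -> : 2 - (2 - (X + Y)) = X + Y by ring.
  by rewrite minC (_ : 1 - Y - (1 - X) = X - Y)//; ring.
exists A; split=> //.
- apply: le_trans PA _; rewrite lee_fin expR_tau.
  have : expR (- VL) <= 1 by rewrite -[leRHS]expR0 ler_expR oppr_le0 VL_ge0.
  by have /andP[d0 d1] := delta01; have := expR_ge0 (- VL); nra.
- move=> x nAx; rewrite leNgt; apply/negP => hx; apply: nAx.
  exact: badA.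
Qed.

End deviation_bounds.

(** * Expectations of tests *)

(** The integral of a nonnegative function is a supremum over the simple functions
below it, hence monotone; this bounds the expectation of [psi], an indicator defined by
a union over the class, by that of an indicator of a measurable set. *)
Lemma le_integral_nonmeasurable d (T : measurableType d) (R : realType)
    (mu : {measure set T -> \bar R}) (f g : T -> \bar R) :
  (forall x, 0 <= f x)%E -> (forall x, f x <= g x)%E ->
  (\int[mu]_x f x <= \int[mu]_x g x)%E.
Proof.
move=> f0 fg; have g0 x : (0 <= g x)%E by exact: le_trans (f0 x) (fg x).
rewrite !ge0_integralTE//; apply: ereal_sup_le => _ [h hf <-].
by exists h => // x; exact: le_trans (hf x) (fg x).
Qed.

Section two_samples.
Context d (T : measurableType d) (R : realType).
Implicit Types (P Q : probability T R).

(** Union bound over the bad events of the two samples. *)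
Lemma expect2_le n P Q (a b : R) (phi : n.-tuple T * n.-tuple T -> R) A B :
  measurable A -> measurable B ->
  (power P n A <= a%:E)%E -> (power Q n B <= b%:E)%E ->
  (forall z, 0 <= phi z <= 1) ->
  (forall z, ~ A z.1 -> ~ B z.2 -> phi z = 0) ->
  (expect2 P Q phi <= (a + b)%:E)%E.
Proof.
move=> mA mB PA QB phi01 phi0; rewrite /expect2 unlock.
set M := (power P n \x power Q n)%E.
have mC : measurable (A `*` setT `|` setT `*` B).
  by apply: measurableU; exact: measurableX.
apply: (@le_trans _ _ (\int[M]_z (\1_(A `*` setT `|` setT `*` B) z)%:E)%E).
  apply: le_integral_nonmeasurable => z; rewrite lee_fin.
    by have /andP[] := phi01 z.
  rewrite indicE; case: (boolP (z \in _)); first by have /andP[] := phi01 z.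
  move=> /negP; rewrite inE => nz; rewrite phi0// => h; apply: nz; [left|right] => //.
rewrite integral_indic// setIT; apply: le_trans (measureU2 _ _ _) _.
- exact: measurableX.
- exact: measurableX.
rewrite [X in (X + _)%E](@product_measure1E _ _ _ _ _ (power P n) (power Q n))//.
rewrite [X in (_ + X)%E](@product_measure1E _ _ _ _ _ (power P n) (power Q n))//.
rewrite [X in (_ * X + _)%E]probability_setT [X in (_ + X * _)%E]probability_setT.
by rewrite mule1 mul1e EFinD; exact: leeD.
Qed.

Lemma is_test_indic S : measurable S -> is_test (\1_S : T -> R).
Proof.
move=> mS; split; first exact: measurable_indic.
by move=> x; rewrite indicE; case: (_ \in _); rewrite ?lexx ?ler01.
Qed.

Lemma Rintegral_indic P S : measurable S -> \int[P]_x (\1_S x) = fine (P S).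
Proof. by move=> mS; rewrite /Rintegral integral_indic// setIT. Qed.

Lemma Rintegral_indicC P S : measurable S ->
  \int[P]_x (1 - \1_S x) = fine (P (~` S)).
Proof.
move=> mS; rewrite -Rintegral_indic; last exact: measurableC.
apply: eq_Rintegral => x _; rewrite !indicE in_setC.
by case: (x \in S); rewrite /= ?subrr ?subr0.
Qed.

Lemma tradeoff_le P Q phi (a : R) : is_test phi -> \int[P]_x phi x <= a ->
  tradeoff P Q a <= \int[Q]_x (1 - phi x).
Proof.
move=> tphi ha; apply: ge_inf; last by exists phi.
exists 0 => _ [psi [[_ psi01] _] <-]; apply: Rintegral_ge0 => x _.
by rewrite subr_ge0; have /andP[] := psi01 x.
Qed.

Lemma tradeoff_lt P Q (a c : R) : 0 <= a -> tradeoff P Q a < c ->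
  exists2 phi, is_test phi /\ \int[P]_x phi x <= a & \int[Q]_x (1 - phi x) < c.
Proof.
move=> a0 /inf_lt[].
  exists (\int[Q]_x (1 - \1_set0 x)); exists \1_set0 => //; split.
    exact: is_test_indic.
  by rewrite Rintegral_indic// measure0.
by move=> _ [phi h <-]; exists phi.
Qed.

End two_samples.

(** * Total variation distance of expectations *)

Section tests.
Context d (T : measurableType d) (R : realType).
Implicit Types (P Q : probability T R) (phi : T -> R).

Lemma integrable_test P phi : is_test phi -> P.-integrable setT (EFin \o phi).
Proof.
move=> [mphi phi01]; apply: measurable_bounded_integrable => //.
  by rewrite [X in (X < _)%E]probability_setT ltry.
exists 1; split => // M M1 x _ /=; have /andP[p0 p1] := phi01 x.
by rewrite ger0_norm// (le_trans p1)// ltW.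
Qed.

Lemma is_testC phi : is_test phi -> is_test (fun x => 1 - phi x).
Proof.
move=> [mphi phi01]; split; first exact: measurable_funB.
by move=> x; have /andP[p0 p1] := phi01 x; apply/andP; split; lra.
Qed.

Lemma dTV_ge P P' A : measurable A -> fine (P A) <= fine (P' A) + dTV P P'.
Proof.
move=> mA; rewrite -lerBlDl; apply: le_trans (ler_norm _) _.
apply: ub_le_sup; last by exists A.
exists 1 => _ [B mB <-].
have /andP[p0 p1] := fine_prob01 P mB; have /andP[q0 q1] := fine_prob01 P' mB.
by rewrite ler_norml; apply/andP; split; lra.
Qed.

Lemma dTVC P P' : dTV P P' = dTV P' P.
Proof.
by congr sup; apply/seteqP; split=> _ [A mA <-]; exists A => //; rewrite distrC.
Qed.

(** An approximation of phi from below within 1 / m, whose expectation is a mean of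
measures of level sets of phi. *)
Definition staircase phi m x : R :=
  (\sum_(k < m) \1_[set y | k.+1%:R <= m%:R * phi y] x) / m%:R.

Lemma staircase_le phi m x : (0 < m)%N -> 0 <= phi x <= 1 ->
  staircase phi m x <= phi x <= staircase phi m x + m%:R^-1.
Proof.
move=> m0 /andP[p0 p1]; have m0' : 0 < m%:R :> R by rewrite ltr0n.
pose c := Num.truncn (m%:R * phi x).
have /andP[c1 c2] : c%:R <= m%:R * phi x < c.+1%:R.
  by apply: truncn_itv; rewrite mulr_ge0.
have cm : (c <= m)%N.
  rewrite -(ler_nat R); apply: le_trans c1 _.
  by rewrite -[leRHS]mulr1 ler_pM2l.
have -> : staircase phi m x = c%:R / m%:R.
  rewrite /staircase; congr (_ / _).
  rewrite (eq_bigr (fun k : 'I_m => (if (k < c)%N then 1 else 0) : R)); last first.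
    move=> k _; rewrite indicE; case: ltnP => kc.
      by rewrite mem_set//=; apply: le_trans c1; rewrite ler_nat.
    rewrite memNset//=; apply/negP; rewrite -ltNge; apply: lt_le_trans c2 _.
    by rewrite ler_nat.
  by rewrite -big_mkcond /= (big_ord_narrow cm) /= sumr_const card_ord.
rewrite ler_pdivrMr// mulrC c1 /=.
by rewrite -[X in _ + X]mul1r -mulrDl ler_pdivlMr// mulrC natr1 ltW.
Qed.

Lemma measurable_level phi m k : is_test phi ->
  measurable [set y | k.+1%:R <= m%:R * phi y].
Proof.
move=> [mphi _]; rewrite -[X in measurable X]setTI.
apply: measurable_fun_le => //.
exact: measurable_funM.
Qed.

Lemma Rintegral_sum_indic P m (A : nat -> set T) : (forall k, measurable (A k)) ->
  \int[P]_x (\sum_(k < m) \1_(A k) x) = \sum_(k < m) fine (P (A k)).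
Proof.
move=> mA.
have mi m' : P.-integrable setT (EFin \o (fun x => \sum_(k < m') \1_(A k) x)).
  apply: measurable_bounded_integrable => //.
  - by rewrite [X in (X < _)%E]probability_setT ltry.
  - by apply: measurable_sum => k _; exact: measurable_indic.
  exists m'%:R; split => // M M1 x _ /=; rewrite ger0_norm; last first.
    by apply: sumr_ge0 => k _; rewrite indicE.
  apply: le_trans (ltW M1); rewrite -[X in _ <= X%:R]card_ord -sum1_card natr_sum.
  by apply: ler_sum => k _; rewrite indicE; case: (_ \in _).
elim: m => [|m IH].
  rewrite big_ord0; under eq_Rintegral do rewrite big_ord0.
  by rewrite Rintegral_cst// mul0r.
rewrite big_ord_recr /= -IH -Rintegral_indic// -RintegralD//.
- by under eq_Rintegral do rewrite big_ord_recr.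
- exact/integrable_test/is_test_indic.
Qed.

(** The total variation distance controls the measure of the level sets, hence the
expectations of the staircase approximations, up to 1 / m for all m. *)
Lemma dTV_test P P' phi : is_test phi ->
  \int[P]_x phi x <= \int[P']_x phi x + dTV P P'.
Proof.
move=> tphi; have [mphi phi01] := tphi.
have lv m k := measurable_level m k tphi.
have mst m : measurable_fun setT (staircase phi m).
  apply: measurable_funM => //; apply: measurable_sum => k _.
  exact: measurable_indic.
have st01 m : (0 < m)%N -> is_test (staircase phi m).
  move=> m0; split => // x; have /andP[h1 h2] := staircase_le m0 (phi01 x).
  have /andP[p0 p1] := phi01 x; rewrite (le_trans h1 p1) andbT.
  by rewrite divr_ge0// sumr_ge0// => k _; rewrite indicE.
have Est (N : probability T R) m : (0 < m)%N -> \int[N]_x staircase phi m x =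
    (\sum_(k < m) fine (N [set y | k.+1%:R <= m%:R * phi y])) / m%:R.
  move=> m0; have lv' k := lv m k.
  rewrite -(Rintegral_sum_indic N m lv') mulrC -RintegralZl//.
    by apply: eq_Rintegral => x _; rewrite /staircase mulrC.
  rewrite (_ : EFin \o _ = fun x => (m%:R%:E * (EFin \o staircase phi m) x)%E).
    by apply: integrableZl => //; exact/integrable_test/st01.
  apply/funext => x; rewrite /staircase /= -EFinM mulrC divfK// gt_eqF// ltr0n//.
have key m : (0 < m)%N ->
    \int[P]_x phi x <= \int[P']_x phi x + dTV P P' + m%:R^-1.
  move=> m0; have m0' : 0 < m%:R :> R by rewrite ltr0n.
  apply: le_trans (_ : \int[P]_x staircase phi m x + m%:R^-1 <= _).
    rewrite -lerBlDr.
    have -> : \int[P]_x phi x - m%:R^-1 = \int[P]_x (phi x - m%:R^-1).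
      rewrite RintegralB//; [|exact: integrable_test|exact: finite_measure_integrable_cst].
      by rewrite Rintegral_cst// [X in fine X]probability_setT mulr1.
    apply: le_Rintegral => //; last first.
    - by move=> x _; have /andP[_] := staircase_le m0 (phi01 x); rewrite lerBlDr.
    - exact: integrable_test (st01 _ m0).
    - have /eq_integrable : P.-integrable setT ((EFin \o phi) \- (EFin \o cst (m%:R^-1)%R))%E.
        apply: integrableB => //; first exact: integrable_test.
        exact: finite_measure_integrable_cst.
      exact.
  rewrite lerD2r.
  apply: le_trans (_ : \int[P']_x staircase phi m x + dTV P P' <= _); last first.
    rewrite lerD2r; apply: le_Rintegral => //;
      [exact: integrable_test (st01 _ m0)|exact: integrable_test|].
    by move=> x _; have /andP[] := staircase_le m0 (phi01 x).
  rewrite !Est// ler_pdivrMr// mulrDl divfK ?gt_eqF//.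
  apply: le_trans (_ : \sum_(k < m) (fine (P' [set y | k.+1%:R <= m%:R * phi y]) + dTV P P') <= _).
    by apply: ler_sum => k _; exact: dTV_ge.
  by rewrite big_split /= sumr_const card_ord mulr_natr.
rewrite -[X in _ <= X]addr0; apply/ler_addgt0Pr => e e0.
rewrite addr0; have [m me] : exists m, (0 < m)%N /\ m%:R^-1 <= e :> R.
  exists (Num.truncn e^-1).+1; split => //.
  rewrite invf_ple ?posrE ?ltr0n//; apply: ltW; exact: truncnS_gt.
by apply: le_trans (key m me.1) _; rewrite lerD2l me.2.
Qed.

End tests.

(** * Neyman-Pearson inequality *)

Section neyman_pearson.
Context d (T : measurableType d) (R : realType).
Implicit Types (P Q N : probability T R) (phi : T -> R).

Lemma midpointE P Q A : midpoint P Q A = ((2^-1)%:E * (P A + Q A))%E.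
Proof. by rewrite /midpoint /mscale [X in (_ * X)%E](measure_addE P Q). Qed.

Lemma midpoint_eq0 P Q A : midpoint P Q A = 0%E -> P A = 0%E /\ Q A = 0%E.
Proof.
rewrite midpointE => /eqP; rewrite mule_eq0 => /orP[|].
  by rewrite eqe invr_eq0 pnatr_eq0.
by rewrite padde_eq0// => /andP[/eqP -> /eqP ->].
Qed.

Lemma dominates_midpoint_l P Q : P `<< midpoint P Q.
Proof.
apply/null_content_dominatesP => A mA h.
by have [] := midpoint_eq0 h.
Qed.

Lemma dominates_midpoint_r P Q : Q `<< midpoint P Q.
Proof.
apply/null_content_dominatesP => A mA h.
by have [] := midpoint_eq0 h.
Qed.

Lemma integrable_density P Q N (f : T -> R) : N `<< midpoint P Q ->
  measurable_fun setT f -> (forall x, -1 <= f x <= 1) ->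
  (midpoint P Q).-integrable setT (EFin \o (fun x => f x * fine (density P Q N x))).
Proof.
move=> dom mf f1; pose p := density P Q N.
have pfin x : p x \is a fin_num by exact: Radon_Nikodym_fin_num.
have : (midpoint P Q).-integrable setT ((EFin \o f) \* p)%E.
  apply: integrableMr => //; last exact: Radon_Nikodym_integrable.
  exists 1; split => // M M1 x _ /=; apply: le_trans (ltW M1).
  by rewrite ler_norml; exact: f1.
by apply: eq_integrable => // x _ /=; rewrite EFinM fineK.
Qed.

Lemma Rintegral_density P Q N (f : T -> R) : N `<< midpoint P Q ->
  measurable_fun setT f -> (forall x, -1 <= f x <= 1) ->
  \int[midpoint P Q]_x (f x * fine (density P Q N x)) = \int[N]_x f x.
Proof.
move=> dom mf f1; rewrite /Rintegral; congr fine.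
rewrite -(@Radon_Nikodym_change_of_variables _ _ _ N (midpoint P Q) dom)//.
  apply: eq_integral => x _; rewrite EFinM fineK//.
  exact: Radon_Nikodym_fin_num.
apply: measurable_bounded_integrable => //.
  by rewrite [X in (X < _)%E]probability_setT ltry.
exists 1; split => // M M1 x _ /=; apply: le_trans (ltW M1).
by rewrite ler_norml; exact: f1.
Qed.

(** Almost everywhere the indicator of S is 1 if q > lam p and 0 otherwise; in both cases
(1_S - phi) (q - lam p) >= 0, and the conclusion is the integral of this
inequality. *)
Lemma neyman_pearson P Q (lam : R) S phi : measurable S -> is_test phi ->
  {ae midpoint P Q, forall x, \1_S x = \1_(NP_region P Q lam%:E) x :> R} ->
  lam * fine (P S) + fine (Q (~` S)) <=
  lam * \int[P]_x phi x + \int[Q]_x (1 - phi x).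
Proof.
move=> mS tphi aeS; have [mphi phi01] := tphi.
have tS := is_test_indic R mS.
have domP := @dominates_midpoint_l P Q; have domQ := @dominates_midpoint_r P Q.
pose f x : R := \1_S x - phi x.
have mf : measurable_fun setT f by apply: measurable_funB => //; exact: measurable_indic.
have f1 x : -1 <= f x <= 1.
  have /andP[p0 p1] := phi01 x; have /andP[s0 s1] := tS.2 x.
  by rewrite /f; apply/andP; split; lra.
have intf N : \int[N]_x f x = fine (N S) - \int[N]_x phi x.
  by rewrite RintegralB// ?Rintegral_indic//; exact: integrable_test.
have intC N phi' : is_test phi' -> \int[N]_x (1 - phi' x) = 1 - \int[N]_x phi' x.
  move=> tp; rewrite RintegralB//; [|exact: finite_measure_integrable_cst|exact: integrable_test].
  by rewrite Rintegral_cst// [X in fine X]probability_setT mulr1.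
suff : 0 <= \int[Q]_x f x - lam * \int[P]_x f x.
  rewrite -(Rintegral_indicC Q mS) !intC// Rintegral_indic// !intf; lra.
rewrite -(Rintegral_density domQ mf f1) -(Rintegral_density domP mf f1).
have iQ := integrable_density domQ mf f1.
have iP := integrable_density domP mf f1.
rewrite -RintegralZl// -RintegralB//; last first.
  have := integrableZl measurableT lam iP; exact: eq_integrable.
set k := fun x => _ - _.
rewrite /Rintegral fine_ge0//.
have mk : measurable_fun setT (EFin \o k).
  apply/measurable_EFinP; apply: measurable_funB.
    by apply/measurable_EFinP; exact: measurable_int iQ.
  apply: measurable_funM => //; apply/measurable_EFinP; exact: measurable_int iP.
(* The integrand is nonnegative only almost everywhere: pass to its positive part. *)
rewrite (@ae_eq_integral _ _ _ _ setT (EFin \o k)^\+%E)//; last 2 first.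
- exact: measurable_funepos.
- apply: filterS aeS => x eS _; rewrite funeposE /= max_l// lee_fin /k.
  have pfin : density P Q P x \is a fin_num by exact: Radon_Nikodym_fin_num.
  have qfin : density P Q Q x \is a fin_num by exact: Radon_Nikodym_fin_num.
  have /andP[p0 p1] := phi01 x.
  have -> : f x * fine (density P Q Q x) - lam * (f x * fine (density P Q P x)) =
      f x * (fine (density P Q Q x) - lam * fine (density P Q P x)) by ring.
  rewrite /f eS indicE; case: (boolP (x \in _)).
    rewrite inE /NP_region /= -(fineK pfin) -(fineK qfin) -EFinM lte_fin => h.
    by rewrite mulr_ge0// subr_ge0// ltW.
  move=> /negP; rewrite inE /NP_region /= -(fineK pfin) -(fineK qfin) -EFinM lte_fin => /negP.
  by rewrite -leNgt => h; rewrite mulr_le0// ?sub0r ?oppr_le0// subr_le0.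
by apply: integral_ge0 => x _; rewrite funepos_ge0.
Qed.

End neyman_pearson.

(** * Convexity and the inflation map *)

Section convexity.
Variable R : realType.
Implicit Types x y z u v th : R.

Lemma sqrt_concave u v z th : 0 <= u -> 0 <= v -> 0 <= th <= 1 ->
  th * u + (1 - th) * v <= z ->
  th * Num.sqrt u + (1 - th) * Num.sqrt v <= Num.sqrt z.
Proof.
move=> u0 v0 /andP[th0 th1] h.
have := sqr_sqrtr u0; have := sqr_sqrtr v0.
set a := Num.sqrt u; set b := Num.sqrt v => b2 a2.
have a0 : 0 <= a by exact: sqrtr_ge0.
have b0 : 0 <= b by exact: sqrtr_ge0.
have c0 : 0 <= th * a + (1 - th) * b by rewrite addr_ge0 ?mulr_ge0// subr_ge0.
rewrite -(ger0_norm c0) -sqrtr_sqr ler_wsqrtr//; apply: le_trans h.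
rewrite -a2 -b2 -subr_ge0.
have -> : th * a ^+ 2 + (1 - th) * b ^+ 2 - (th * a + (1 - th) * b) ^+ 2 =
  th * (1 - th) * (a - b) ^+ 2 by ring.
by apply: mulr_ge0; [apply: mulr_ge0 => //; lra|exact: sqr_ge0].
Qed.

(** Take for lam the supremum of the slopes to the right of x0, with the sign
changed; convexity bounds them by the slopes to the left.  As x0 > 0, there is a
slope to the left, and the supremum is finite. *)
Lemma subgradient (G : R -> R) (x0 : R) : 0 < x0 ->
  (forall x y, 0 <= x -> x <= y -> G y <= G x) ->
  (forall x y th, 0 <= x -> 0 <= y -> 0 <= th <= 1 ->
    G (th * x + (1 - th) * y) <= th * G x + (1 - th) * G y) ->
  exists2 lam, 0 <= lam & forall y, 0 <= y -> G x0 - lam * (y - x0) <= G y.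
Proof.
move=> x00 Gmono Gconv.
pose E := [set (G x0 - G y) / (y - x0) | y in [set y | x0 < y]].
have slope u y : 0 <= u -> u < x0 -> x0 < y ->
    (G x0 - G y) / (y - x0) <= (G u - G x0) / (x0 - u).
  move=> u0 ux xy; rewrite ler_pdivrMr ?subr_gt0// mulrAC ler_pdivlMr ?subr_gt0//.
  have yu : 0 < y - u by lra.
  pose th := (y - x0) / (y - u).
  have e : th * u + (1 - th) * y = x0 by rewrite /th; field; rewrite gt_eqF.
  have th01 : 0 <= th <= 1.
    by rewrite divr_ge0 ?ler_pdivrMr//=; lra.
  have := Gconv u y th u0 _ th01; rewrite e => /(_ ltac:(lra)).
  have -> : th * G u + (1 - th) * G y = ((y - x0) * G u + (x0 - u) * G y) / (y - u).
    by rewrite /th; field; rewrite gt_eqF.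
  by rewrite ler_pdivlMr//; nra.
have ubE : ubound E ((G 0 - G x0) / (x0 - 0)).
  by move=> _ [y /= xy <-]; exact: slope.
have supE : has_sup E.
  split; last by exists ((G 0 - G x0) / (x0 - 0)).
  by exists ((G x0 - G (x0 + 1)) / (x0 + 1 - x0)); exists (x0 + 1) => //=; lra.
exists (sup E).
  apply: le_trans (_ : (G x0 - G (x0 + 1)) / (x0 + 1 - x0) <= _).
    rewrite divr_ge0 ?subr_ge0 //; last by lra.
    by apply: Gmono; lra.
  by apply: ub_le_sup; [case: supE|exists (x0 + 1) => //=; lra].
move=> y y0; have [yx|xy|->] := ltgtP y x0; last by rewrite subrr mulr0 subr0.
  have : sup E <= (G y - G x0) / (x0 - y).
    by apply: ge_sup => [|_ [z /= xz <-]]; [case: supE|exact: slope].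
  by rewrite ler_pdivlMr ?subr_gt0//; lra.
have : (G x0 - G y) / (y - x0) <= sup E.
  by apply: ub_le_sup; [case: supE|exists y].
by rewrite ler_pdivrMr ?subr_gt0//; lra.
Qed.

Lemma tradeoff_function_convex f x y th : is_tradeoff_function f ->
  0 <= x <= 1 -> 0 <= y <= 1 -> 0 <= th <= 1 ->
  f (th * x + (1 - th) * y) <= th * f x + (1 - th) * f y.
Proof.
move=> tf x01 y01 th01.
have /andP[th0 th1] := th01.
have := @tf_convex _ _ tf (Itv01 th0 th1) x y.
rewrite !inE /= !in_itv /= => /(_ x01 y01).
by rewrite !convRE.
Qed.

End convexity.

Section hplus_convexity.
Context (T : Type) (R : realType) (SS : set (set T)) (n : nat) (delta : R).
Local Notation t := (tau SS n delta).
Local Notation h := (hplus SS n delta).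
Local Notation hinv := (hplus_inv SS n delta).
Hypothesis t0 : 0 < t.
Implicit Types x y u v th : R.

Lemma hplus_le1 x : h x <= 1.
Proof. by rewrite /hplus ge_min lexx orbT. Qed.

Lemma hplus_ge0 x : 0 <= x -> 0 <= h x.
Proof. by move=> x0; rewrite le_min ler01 andbT !addr_ge0 ?sqrtr_ge0// ltW. Qed.

(** So [hplus] is 1 on [1 - tau, +oo[, which makes it monotone although the
square root term decreases near 1. *)
Lemma hplus_eq1 x : 1 <= x + t -> h x = 1.
Proof.
move=> xt; rewrite /hplus min_r//; apply: le_trans xt _.
by rewrite lerD2r lerDl sqrtr_ge0.
Qed.

(** If y + tau < 1 and y > 1/2, then sqrt (tau (1 - y)) >= tau, and the decrease of
the square root between x and y is at most y - x. *)
Lemma hplus_mono x y : 0 <= x -> x <= y -> h x <= h y.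
Proof.
have t0' := t0; move=> x0 xy; have [yt|yt] := leP 1 (y + t);
  first by rewrite (hplus_eq1 yt) hplus_le1.
have y1 : y <= 1 by have := t0; lra.
rewrite /hplus !VfunE//; last exact: le_trans y1.
suff : x + Num.sqrt (t * spread x) <= y + Num.sqrt (t * spread y).
  by move=> le; rewrite le_min ge_min lerD2r le/= ge_min lexx orbT.
have [yl|yl] := leP y (1 - y).
  apply: lerD => //; rewrite ler_wsqrtr// ler_pM2l// /spread.
  by rewrite (min_l yl) ge_min xy.
have sy : spread y = 1 - y by rewrite /spread min_r// ltW.
have sx : spread x <= spread y + (y - x) by rewrite sy /spread ge_min; apply/orP; right; lra.
have sx0 : 0 <= spread x by apply: spread_ge0; apply/andP; split; lra.
set a := Num.sqrt (t * spread y).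
have a0 : 0 <= a by exact: sqrtr_ge0.
have a2 : a ^+ 2 = t * spread y by rewrite sqr_sqrtr// mulr_ge0 ?(ltW t0)// sy; lra.
suff : Num.sqrt (t * spread x) <= a + (y - x) by lra.
have c0 : 0 <= a + (y - x) by lra.
rewrite -(ger0_norm c0) -sqrtr_sqr ler_wsqrtr//.
have ta : t <= a.
  by rewrite -(ger0_norm (ltW t0)) -sqrtr_sqr ler_wsqrtr// expr2 ler_pM2l// sy; lra.
by nra.
Qed.

(** On [0, 1] this is the concavity of the square root and of the spread.  Beyond 1
the function is constant, so points can be moved back to 1. *)
Lemma hplus_concave x y th : 0 <= x -> 0 <= y -> 0 <= th <= 1 ->
  th * h x + (1 - th) * h y <= h (th * x + (1 - th) * y).
Proof.
have t0' := t0; move=> x0 y0 /andP[th0 th1].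
have hmin u : h u = h (Num.min u 1).
  by case: (leP u 1) => // u1; rewrite !hplus_eq1//; lra.
pose x' := Num.min x 1; pose y' := Num.min y 1.
have x'0 : 0 <= x' by rewrite le_min x0 ler01.
have y'0 : 0 <= y' by rewrite le_min y0 ler01.
have x'1 : x' <= 1 by rewrite ge_min lexx orbT.
have y'1 : y' <= 1 by rewrite ge_min lexx orbT.
have x'x : x' <= x by rewrite ge_min lexx.
have y'y : y' <= y by rewrite ge_min lexx.
have th1' : 0 <= 1 - th by lra.
have z0 : 0 <= th * x' + (1 - th) * y' by rewrite addr_ge0// mulr_ge0.
apply: le_trans (_ : h (th * x' + (1 - th) * y') <= _); last first.
  by apply: hplus_mono => //; apply: lerD; rewrite ler_wpM2l.
rewrite (hmin x) (hmin y) -/x' -/y'.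
have z1 : th * x' + (1 - th) * y' <= 1 by nra.
rewrite [leRHS]/hplus le_min; apply/andP; split; last first.
  by have := hplus_le1 x'; have := hplus_le1 y'; nra.
rewrite VfunE//.
have hb u : 0 <= u <= 1 -> h u <= u + Num.sqrt (t * spread u) + t.
  by move=> /andP[u0 u1]; rewrite /hplus VfunE// ge_min lexx.
have s : th * Num.sqrt (t * spread x') + (1 - th) * Num.sqrt (t * spread y') <=
    Num.sqrt (t * spread (th * x' + (1 - th) * y')).
  apply: sqrt_concave; rewrite ?th0 ?th1//.
  - by rewrite mulr_ge0 ?(ltW t0)// spread_ge0// x'0.
  - by rewrite mulr_ge0 ?(ltW t0)// spread_ge0// y'0.
  rewrite !(mulrCA _ t) -mulrDr ler_pM2l// /spread le_min.
  have m1 : Num.min x' (1 - x') <= x' by rewrite ge_min lexx.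
  have m2 : Num.min x' (1 - x') <= 1 - x' by rewrite ge_min lexx orbT.
  have m3 : Num.min y' (1 - y') <= y' by rewrite ge_min lexx.
  have m4 : Num.min y' (1 - y') <= 1 - y' by rewrite ge_min lexx orbT.
  by apply/andP; split; nra.
have := hb x'; have := hb y'; rewrite x'0 x'1 y'0 y'1 => /(_ isT) h1 /(_ isT) h2.
by nra.
Qed.

Let hset u := [set s | 0 <= s <= 1 /\ u <= h s].

Let hset_lb u : has_lbound (hset u).
Proof. by exists 0 => s [/andP[]]. Qed.

Lemma hplus_inv_le u s : 0 <= s <= 1 -> u <= h s -> hinv u <= s.
Proof. by move=> s01 us; apply: (ge_inf (hset_lb u)). Qed.

Let hset1 u : u <= 1 -> hset u 1.
Proof. by move=> u1; split; [rewrite ler01 lexx|rewrite hplus_eq1//; have := t0; lra]. Qed.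

Lemma hplus_inv_itv u : u <= 1 -> 0 <= hinv u <= 1.
Proof.
move=> u1; apply/andP; split; last by apply: (ge_inf (hset_lb u)); exact: hset1.
by apply: lb_le_inf; [exists 1; exact: hset1|move=> s [/andP[]]].
Qed.

Lemma hplus_inv_mono u v : v <= 1 -> u <= v -> hinv u <= hinv v.
Proof.
move=> v1 uv; apply: lb_le_inf; first by exists 1; exact: hset1.
by move=> s [s01 vs]; apply: hplus_inv_le => //; exact: le_trans vs.
Qed.

(** The generalized inverse of a concave nondecreasing function is convex.  The
infimum is replaced by a point of the set within e of it. *)
Lemma hplus_inv_convex u v th : u <= 1 -> v <= 1 -> 0 <= th <= 1 ->
  hinv (th * u + (1 - th) * v) <= th * hinv u + (1 - th) * hinv v.
Proof.
move=> u1 v1 /[dup] th01 /andP[th0 th1]; apply/ler_addgt0Pr => e e0.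
have [s [/[dup] s01 /andP[s0 s1] us] se] : exists2 s, hset u s & s < hinv u + e.
  by apply: inf_lt; [exists 1; exact: hset1|rewrite ltrDl].
have [r [/[dup] r01 /andP[r0 r1] vr] re] : exists2 r, hset v r & r < hinv v + e.
  by apply: inf_lt; [exists 1; exact: hset1|rewrite ltrDl].
apply: le_trans (_ : th * s + (1 - th) * r <= _); last by nra.
apply: hplus_inv_le; first by apply/andP; split; nra.
by apply: le_trans (hplus_concave s0 r0 th01); nra.
Qed.

End hplus_convexity.

(** * Separating sets and error control *)

Section power.
Context d (T : measurableType d) (R : realType).
Variables (SS : set (set T)) (n : nat) (delta : R) (f0 : R -> R).
Local Notation h := (hplus SS n delta).
Local Notation hinv := (hplus_inv SS n delta).
Hypothesis t0 : 0 < tau SS n delta.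
Hypothesis tf0 : is_tradeoff_function f0.
Implicit Types (P Q : probability T R) (x y th : R).

Definition tradeoff_bound x := hinv (hinv (f0 (h (h x)))).
Local Notation G := tradeoff_bound.

Let h01 x : 0 <= x -> 0 <= h x <= 1.
Proof. by move=> x0; rewrite hplus_ge0// hplus_le1. Qed.

Let f0_01 x : 0 <= x <= 1 -> 0 <= f0 x <= 1.
Proof. by move=> x01; apply: (tf_range tf0); rewrite in_itv. Qed.

Let f0_mono x y : 0 <= x <= 1 -> 0 <= y <= 1 -> x <= y -> f0 y <= f0 x.
Proof. by move=> x01 y01; apply: (tf_nonincreasing tf0); rewrite in_itv. Qed.

Let hh01 x : 0 <= x -> 0 <= h (h x) <= 1.
Proof. by move=> /h01/andP[hx _]; exact: h01. Qed.

Let f01 x : 0 <= x -> f0 (h (h x)) <= 1.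
Proof. by move=> /hh01/f0_01/andP[]. Qed.

Let hinv01 u : u <= 1 -> 0 <= hinv u <= 1.
Proof. exact: hplus_inv_itv. Qed.

Lemma tradeoff_bound_mono x y : 0 <= x -> x <= y -> G y <= G x.
Proof.
move=> x0 xy; have y0 : 0 <= y := le_trans x0 xy.
have hx0 : 0 <= h x by exact: hplus_ge0.
apply: hplus_inv_mono => //; first by have /andP[] := hinv01 (f01 x0).
apply: hplus_inv_mono => //; first exact: f01.
apply: f0_mono; [exact: hh01|exact: hh01|].
by apply: hplus_mono => //; exact: hplus_mono.
Qed.

(** A nonincreasing convex function of a concave one is convex, and so is a
nondecreasing convex function of a convex one. *)
Lemma tradeoff_bound_convex x y th : 0 <= x -> 0 <= y -> 0 <= th <= 1 ->
  G (th * x + (1 - th) * y) <= th * G x + (1 - th) * G y.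
Proof.
move=> x0 y0 /[dup] th01 /andP[th0 th1]; have th1' : 0 <= 1 - th by rewrite subr_ge0.
set z := th * x + (1 - th) * y.
have z0 : 0 <= z by rewrite addr_ge0// mulr_ge0.
have hx0 : 0 <= h x by exact: hplus_ge0.
have hy0 : 0 <= h y by exact: hplus_ge0.
have conc : th * h (h x) + (1 - th) * h (h y) <= h (h z).
  apply: le_trans (hplus_concave t0 hx0 hy0 th01) _.
  apply: hplus_mono => //; first by rewrite addr_ge0// mulr_ge0.
  exact: hplus_concave.
have /andP[ux0 ux1] := hh01 x0; have /andP[uy0 uy1] := hh01 y0.
have mix01 : 0 <= th * h (h x) + (1 - th) * h (h y) <= 1.
  by apply/andP; split; [rewrite addr_ge0// mulr_ge0|nra].
have fconv : f0 (h (h z)) <= th * f0 (h (h x)) + (1 - th) * f0 (h (h y)).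
  apply: le_trans (f0_mono mix01 (hh01 z0) conc) _.
  by apply: tradeoff_function_convex; rewrite ?ux0 ?uy0.
have fx1 := f01 x0; have fy1 := f01 y0.
have fmix1 : th * f0 (h (h x)) + (1 - th) * f0 (h (h y)) <= 1 by nra.
have iconv : hinv (f0 (h (h z))) <=
    th * hinv (f0 (h (h x))) + (1 - th) * hinv (f0 (h (h y))).
  apply: le_trans (hplus_inv_mono t0 fmix1 fconv) _.
  exact: hplus_inv_convex.
have /andP[_ ix1] := hinv01 fx1; have /andP[_ iy1] := hinv01 fy1.
have imix1 : th * hinv (f0 (h (h x))) + (1 - th) * hinv (f0 (h (h y))) <= 1 by nra.
apply: le_trans (hplus_inv_mono t0 imix1 iconv) _.
exact: hplus_inv_convex.
Qed.

Lemma tradeoff_bound_le x y : 0 <= x -> 0 <= y <= 1 ->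
  f0 (h (h x)) <= h (h y) -> G x <= y.
Proof.
move=> x0 y01 le; have /andP[y0 y1] := y01.
by apply: hplus_inv_le => //; apply: hplus_inv_le => //; exact: h01.
Qed.

(** The Neyman-Pearson region of threshold lam for the attainable pair (P', Q'),
where - lam is a subgradient of the bound at a + 2 eta1.  One eta1 and one eta2 are
lost in moving phi from (P, Q) to (P', Q'), and one more of each in moving the region
back. *)
Lemma exists_separating_set P Q eta1 eta2 (a : R) (phi : T -> R) :
  0 <= eta1 -> 0 <= eta2 -> SS `<=` measurable ->
  approx_attainable SS eta1 eta2 P Q ->
  0 < a -> is_test phi -> \int[P]_x phi x <= a ->
  \int[Q]_x (1 - phi x) < G (a + 2 * eta1) - 2 * eta2 ->
  exists2 S, SS S & h (h (fine (Q (~` S)))) < f0 (h (h (fine (P S)))).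
Proof.
move=> e1 e2 mSS [P' [Q' [att dP dQ]]] a0 tphi Ea Eb.
set x0 := a + 2 * eta1 in Eb *.
have x00 : 0 < x0 by rewrite /x0; lra.
have [lam lam0 sub] := subgradient x00 tradeoff_bound_mono tradeoff_bound_convex.
have lamE : (0 <= lam%:E)%E by rewrite lee_fin.
have [S SSS aeS] := att _ lamE; have mS := mSS _ SSS.
exists S => //; rewrite ltNge; apply/negP => le.
have /andP[p0 p1] := fine_prob01 P mS.
have /andP[p0' p1'] := fine_prob01 P' mS.
have q01 := fine_prob01 Q (measurableC mS).
have GQ := tradeoff_bound_le p0 q01 le.
have np := neyman_pearson mS tphi aeS.
have PS : fine (P S) <= fine (P' S) + eta1.
  by apply: le_trans (dTV_ge P P' mS) _; rewrite lerD2l.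
have QS : fine (Q (~` S)) <= fine (Q' (~` S)) + eta2.
  by apply: le_trans (dTV_ge Q Q' (measurableC mS)) _; rewrite lerD2l.
have Pphi : \int[P']_x phi x <= \int[P]_x phi x + eta1.
  by apply: le_trans (dTV_test P' P tphi) _; rewrite lerD2l dTVC.
have Qphi : \int[Q']_x (1 - phi x) <= \int[Q]_x (1 - phi x) + eta2.
  by apply: le_trans (dTV_test Q' Q (is_testC tphi)) _; rewrite lerD2l dTVC.
have y0 : 0 <= fine (P' S) + eta1 by rewrite addr_ge0.
have := sub _ y0; have Gm := tradeoff_bound_mono p0 PS.
have l1 : lam * \int[P']_x phi x <= lam * (a + eta1).
  by rewrite ler_wpM2l//; lra.
by rewrite /x0; lra.
Qed.

End power.

(** The subgradient argument needs a positive abscissa; continuity at 0 provides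
one without losing the strict inequality. *)
Lemma attained_right_of_zero (R : realType) (f1 : R -> R) (a c : R) :
  is_tradeoff_function f1 -> 0 <= a <= 1 -> 0 <= c -> c < f1 a ->
  exists b, [/\ a <= b, 0 < b <= 1 & c < f1 b].
Proof.
move=> tf1 /andP[a0 a1] c0 ca.
have [a_eq|ane] := eqVneq a 0; last first.
  by exists a; rewrite lexx a1 lt_neqAle eq_sym ane a0.
have := tf_continuous tf1; rewrite continuous_within_itvP// => -[_ cv _].
rewrite a_eq in ca *.
have h1 : \forall y \near (0 : R)^'+, c < f1 y by apply: (cvgr_gt (f1 0)) => //.
have h2 : \forall y \near (0 : R)^'+, y <= 1 by exact: nbhs_right_le.
have h3 : \forall y \near (0 : R)^'+, 0 < y by exact: nbhs_right_gt.
near (0 : R)^'+ => b; exists b; split.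
- by rewrite ltW//; near: b.
- by apply/andP; split; near: b.
- by near: b.
Unshelve. all: by end_near.
Qed.

Theorem theorem6p1 (R : realType) (d : measure_display) (T : measurableType d)
  (delta eta1 eta2 : R) (SS : set (set T)) (n : nat) (f0 f1 : R -> R) :
  0 < delta < 1 -> 0 <= eta1 -> 0 <= eta2 ->
  SS `<=` measurable -> measurable_traces SS -> (VC R SS < +oo)%E ->
  (0 < n)%N -> tau SS n delta <= 2^-1 ->
  is_tradeoff_function f0 -> is_tradeoff_function f1 -> tf_ge f0 f1 ->
  (ereal_sup
     [set expect2 PQ.1 PQ.2 (@psi d T R SS n delta f0) |
      PQ in [set PQ : probability T R * probability T R |
             tf_ge (tradeoff PQ.1 PQ.2) f0]]
   <= delta%:E)%E
  /\
  (SS set0 -> SS setT ->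
   (forall a, 0 <= a <= 1 ->
      f1 a <= Num.max
        (hplus_inv SS n delta (hplus_inv SS n delta
           (f0 (hplus SS n delta (hplus SS n delta (a + 2 * eta1)))))
         - 2 * eta2) 0) ->
   (ereal_sup
      [set expect2 PQ.1 PQ.2 (fun xy => 1 - @psi d T R SS n delta f0 xy)%R |
       PQ in [set PQ : probability T R * probability T R |
              approx_attainable SS eta1 eta2 PQ.1 PQ.2 /\
              tf_nge (tradeoff PQ.1 PQ.2) f1]]
    <= delta%:E)%E).
Proof.
move=> delta01 e1 e2 mSS mt VCoo n0 _ tf0 tf1 _.
have t0 := tau_gt0 delta01 n0 VCoo.
have h01 x : 0 <= x -> 0 <= hplus SS n delta x <= 1.
  by move=> x0; rewrite hplus_ge0// hplus_le1.
have emp01 (x : n.-tuple T) S : 0 <= empirical R x S <= 1.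
  by rewrite empiricalE; exact: (ratio01 _ n0 (count_in_le S x)).
have hemp01 (x : n.-tuple T) S : 0 <= hplus SS n delta (empirical R x S) <= 1.
  by apply: h01; have /andP[] := emp01 x S.
have f0_mono x y : 0 <= x <= 1 -> 0 <= y <= 1 -> x <= y -> f0 y <= f0 x.
  by move=> x01 y01; apply: (tf_nonincreasing tf0); rewrite in_itv.
have psi01 xy : 0 <= @psi d T R SS n delta f0 xy <= 1.
  by rewrite /psi indicE; case: (_ \in _); rewrite ?lexx ?ler01.
split.
  apply: ge_ereal_sup => _ [[P Q] /= PQf0 <-].
  have [A [mA PA hA]] := uniform_upper_bound delta01 n0 VCoo P mSS mt.
  have VCoo' : (VC R (complements SS) < +oo)%E by rewrite VC_complements.
  have mSS' : complements SS `<=` measurable.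
    by move=> _ [S SSS <-]; apply: measurableC; exact: mSS.
  have [B [mB QB hB]] := uniform_upper_bound delta01 n0 VCoo' Q mSS'
    (measurable_traces_complements mt).
  rewrite [X in (_ <= X%:E)%E]splitr; apply: (expect2_le mA mB PA QB psi01) => -[x y] /= nA nB.
  rewrite /psi indicE memNset// => -[S SSS] /=; apply/negP; rewrite -leNgt.
  have mS := mSS _ SSS.
  have PS := hA _ nA _ SSS.
  have QS : fine (Q (~` S)) <= hplus SS n delta (empirical R y (~` S)).
    have -> : hplus SS n delta = hplus (complements SS) n delta.
      by apply/funext => u; rewrite /hplus /tau VC_complements.
    by apply: hB => //; exists S.
  apply: le_trans QS; have p01 := fine_prob01 P mS.
  apply: le_trans (f0_mono _ _ p01 (hemp01 _ _) PS) _.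
  apply: le_trans (PQf0 _ p01) _.
  rewrite -(Rintegral_indicC Q mS); apply: tradeoff_le; first exact: is_test_indic.
  by rewrite Rintegral_indic.
move=> _ _ hf1; apply: ge_ereal_sup => _ [[P Q] /= [att [a a01 Tf]] <-].
have /andP[a0 a1] := a01.
have [phi [tphi Ea] Eb] := tradeoff_lt a0 Tf.
have Eb0 : 0 <= \int[Q]_x (1 - phi x).
  by apply: Rintegral_ge0 => x _; have /andP[] := (is_testC tphi).2 x.
have [b [ab /andP[b0 b1] Ebb]] := attained_right_of_zero tf1 a01 Eb0 Eb.
have EG : \int[Q]_x (1 - phi x) < tradeoff_bound SS n delta f0 (b + 2 * eta1) - 2 * eta2.
  have b01 : 0 <= b <= 1 by rewrite b1 ltW.
  have := lt_le_trans Ebb (hf1 _ b01); rewrite lt_max => /orP[//|].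
  by rewrite ltNge Eb0.
have [S SSS sep] := exists_separating_set t0 tf0 e1 e2 mSS att b0 tphi (le_trans Ea ab) EG.
have mS := mSS _ SSS; have mSC := measurableC mS.
have [A [mA PA hA]] := single_lower_bound delta01 n0 VCoo P mS.
have [B [mB QB hB]] := single_lower_bound delta01 n0 VCoo Q mSC.
rewrite [X in (_ <= X%:E)%E]splitr; apply: (expect2_le mA mB PA QB).
  by move=> z; have /andP[p0 p1] := psi01 z; apply/andP; split; lra.
move=> [x y] /= nA nB; rewrite /psi indicE mem_set ?subrr//=; exists S => //.
have /andP[P0 P1] := fine_prob01 P mS; have /andP[ex0 _] := emp01 x S.
have /andP[ey0 _] := emp01 y (~` S).
apply: le_lt_trans (hplus_mono t0 ey0 (hB _ nB)) (lt_le_trans sep _).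
apply: f0_mono => //; last exact: hplus_mono (hA _ nA).
by apply: h01; exact: hplus_ge0.
Qed.
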